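(* Let $k$ be a commutative ring, $G$ a finite group, and $V$ a $kG$-module that is free of finite rank over $k$. Let $\mathbf{C}$ denote any of the categories $\mathbf{cpxFL}(kG)$, $\mathbf{cpxFL}^+(kG)$, $\mathbf{cpxFL}^-(kG)$ or $\mathbf{cpxFL}^b(kG)$. Then $\mathbf{C}$ has idempotent completions (every idempotent endomorphism in $\mathbf{C}$ splits), and so does each of the homotopy categories $\mathcal{K}(\mathbf{C})$, $\mathcal{K}_{V\text{-split}}(\mathbf{C})$, $\mathcal{K}_{\mathrm{ts}+V\text{-split}}(\mathbf{C})$ and $\mathcal{K}_{V\text{-ts}}(\mathbf{C})$.
   Context: $\mathbf{cpxFL}(kG)$ is the category of cochain complexes $\cdots\to X^n\to X^{n+1}\to\cdots$ of $kG$-modules, with chain maps, such that every term $X^n$ has finite composition length; $\mathbf{cpxFL}^+$, $\mathbf{cpxFL}^-$, $\mathbf{cpxFL}^b$ are the full subcategories of complexes bounded above, bounded below, and both. $\otimes=\otimes_k$ with diagonal $G$-action. An exact sequence $E$ of complexes is term split if in each degree it is a split sequence of $kG$-modules; $V$-split if $V\otimes E$ is split as a sequence of complexes; $V$-term split if $V\otimes E$ is term split; term+$V$-split if it is both term split and $V$-split. For a class $\mathscr{E}$ of exact sequences in $\mathbf{C}$, an object $P$ is $\mathscr{E}$-projective if $\mathrm{Hom}(P,-)$ sends each sequence in $\mathscr{E}$ to an exact sequence. $\mathbf{C}/\mathscr{E}\text{-}\mathbf{Proj}$ has the objects of $\mathbf{C}$ and the morphisms of $\mathbf{C}$ modulo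 those factoring through an $\mathscr{E}$-projective object. $\mathcal{K}(\mathbf{C})$ (the usual homotopy category), $\mathcal{K}_{V\text{-split}}(\mathbf{C})$, $\mathcal{K}_{V\text{-ts}}(\mathbf{C})$, $\mathcal{K}_{\mathrm{ts}+V\text{-split}}(\mathbf{C})$ denote this quotient for $\mathscr{E}$ the class of term split, $V$-split, $V$-term split, term+$V$-split sequences in $\mathbf{C}$, respectively. An idempotent $e:X\to X$ in an additive category splits if $X$ is a direct sum $X'\oplus X''$ such that $e$ is the identity on $X'$ and zero on $X''$. *)

(* Defs.v *)
From HB Require Import structures.
From mathcomp Require Import all_boot all_order all_fingroup all_algebra.
From mathcomp Require Import ring_quotient generic_quotient.
From mathcomp Require Import boolp classical_sets.

Set Implicit Arguments.
Unset Strict Implicit.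
Unset Printing Implicit Defensive.

Import GRing.Theory.
Local Open Scope ring_scope.

Record addCat := AddCat {
  obj :> Type;
  hom : obj -> obj -> zmodType;
  idm : forall X, hom X X;
  ccomp : forall X Y Z, hom Y Z -> hom X Y -> hom X Z;
  ccompA : forall W X Y Z (h : hom Y Z) (g : hom X Y) (f : hom W X),
    ccomp h (ccomp g f) = ccomp (ccomp h g) f;
  ccomp1l : forall X Y (f : hom X Y), ccomp (idm Y) f = f;
  ccomp1r : forall X Y (f : hom X Y), ccomp f (idm X) = f;
  ccompDl : forall X Y Z (g h : hom Y Z) (f : hom X Y),
    ccomp (g + h) f = ccomp g f + ccomp h f;
  ccompDr : forall X Y Z (h : hom Y Z) (f g : hom X Y),
    ccomp h (f + g) = ccomp h f + ccomp h g;
  zob : obj;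
  zobP : idm zob = 0;
  dsum : obj -> obj -> obj;
  in1 : forall X Y, hom X (dsum X Y);
  in2 : forall X Y, hom Y (dsum X Y);
  pr1 : forall X Y, hom (dsum X Y) X;
  pr2 : forall X Y, hom (dsum X Y) Y;
  dsumP : forall X Y,
    [/\ ccomp (pr1 X Y) (in1 X Y) = idm X,
        ccomp (pr2 X Y) (in2 X Y) = idm Y,
        ccomp (pr1 X Y) (in2 X Y) = 0,
        ccomp (pr2 X Y) (in1 X Y) = 0
      & ccomp (in1 X Y) (pr1 X Y) + ccomp (in2 X Y) (pr2 X Y)
          = idm (dsum X Y)]
}.

Arguments hom {a} X Y.
Arguments idm {a} X.
Arguments ccomp {a X Y Z} g f : rename.
Arguments zob a : clear implicits.
Arguments dsum {a} X Y.
Arguments in1 {a} X Y.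
Arguments in2 {a} X Y.
Arguments pr1 {a} X Y.
Arguments pr2 {a} X Y.

Declare Scope cat_scope.
Delimit Scope cat_scope with cat.
Notation "g ∘ f" := (ccomp g f) (at level 40, left associativity) : cat_scope.
Local Open Scope cat_scope.

Definition is_biproduct (A : addCat) (X1 X2 X : A)
    (i1 : hom X1 X) (i2 : hom X2 X) (p1 : hom X X1) (p2 : hom X X2) : Prop :=
  [/\ p1 ∘ i1 = idm X1, p2 ∘ i2 = idm X2, p1 ∘ i2 = 0, p2 ∘ i1 = 0
    & i1 ∘ p1 + i2 ∘ p2 = idm X].

Definition idempotent_splits (A : addCat) (X : A) (e : hom X X) : Prop :=
  exists (X1 X2 : A) (i1 : hom X1 X) (i2 : hom X2 X)
         (p1 : hom X X1) (p2 : hom X X2),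
    [/\ is_biproduct i1 i2 p1 p2, e ∘ i1 = i1 & e ∘ i2 = 0].

Definition has_idempotent_completions (A : addCat) : Prop :=
  forall (X : A) (e : hom X X), e ∘ e = e -> idempotent_splits e.

Section AddCatTheory.
Variable A : addCat.
Implicit Types W X Y Z : A.

Lemma ccomp0l X Y Z (f : hom X Y) : (0 : hom Y Z) ∘ f = 0.
Proof. by apply: (addrI ((0 : hom Y Z) ∘ f)); rewrite -ccompDl !addr0. Qed.

Lemma ccomp0r X Y Z (f : hom Y Z) : f ∘ (0 : hom X Y) = 0.
Proof. by apply: (addrI (f ∘ (0 : hom X Y))); rewrite -ccompDr !addr0. Qed.

Lemma ccompNl X Y Z (g : hom Y Z) (f : hom X Y) : (- g) ∘ f = - (g ∘ f).
Proof. by apply/eqP; rewrite -addr_eq0 -ccompDl addNr ccomp0l. Qed.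

Lemma ccompNr X Y Z (g : hom Y Z) (f : hom X Y) : g ∘ (- f) = - (g ∘ f).
Proof. by apply/eqP; rewrite -addr_eq0 -ccompDr addNr ccomp0r. Qed.

Lemma ccompBl X Y Z (g h : hom Y Z) (f : hom X Y) :
  (g - h) ∘ f = g ∘ f - h ∘ f.
Proof. by rewrite ccompDl ccompNl. Qed.

Lemma ccompBr X Y Z (h : hom Y Z) (f g : hom X Y) :
  h ∘ (f - g) = h ∘ f - h ∘ g.
Proof. by rewrite ccompDr ccompNr. Qed.

Lemma zob_homl X (f : hom (zob A) X) : f = 0.
Proof. by rewrite -[f]ccomp1r zobP ccomp0r. Qed.

End AddCatTheory.

Record addFunctor (A B : addCat) := AddFunctor {
  fob :> A -> B;
  fmap : forall X Y : A, hom X Y -> hom (fob X) (fob Y);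
  fmap1 : forall X, fmap (idm X) = idm (fob X);
  fmapM : forall X Y Z (g : hom Y Z) (f : hom X Y),
    fmap (g ∘ f) = fmap g ∘ fmap f;
  fmapD : forall X Y (f g : hom X Y), fmap (f + g) = fmap f + fmap g
}.

Lemma fmap0 (A B : addCat) (F : addFunctor A B) (X Y : A) :
  fmap F (0 : hom X Y) = 0.
Proof. by apply: (addrI (fmap F (0 : hom X Y))); rewrite -fmapD !addr0. Qed.

(* Sequences X -> Y -> Z; the outer zeros of 0 -> X -> Y -> Z -> 0 are left   *)
(* implicit and are accounted for by the notions of exactness below.          *)
Record seq3 (A : addCat) := Seq3 {
  sX : A; sY : A; sZ : A;
  smap1 : hom sX sY;
  smap2 : hom sY sZ
}.

Definition seq3_map (A B : addCat) (F : addFunctor A B) (S : seq3 A) : seq3 B :=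
  Seq3 (fmap F (smap1 S)) (fmap F (smap2 S)).

(* Equivalently: 0 -> X -> Y -> Z -> 0 is exact and Y -> Z has a section. *)
Definition split_seq (A : addCat) (S : seq3 A) : Prop :=
  exists (r : hom (sY S) (sX S)) (s : hom (sZ S) (sY S)),
    is_biproduct (smap1 S) s r (smap2 S).

Definition hom_exact (A : addCat) (P : A) (S : seq3 A) : Prop :=
  [/\ injective (fun f : hom P (sX S) => smap1 S ∘ f),
      forall g : hom P (sY S),
        smap2 S ∘ g = 0 <-> exists f : hom P (sX S), smap1 S ∘ f = g
    & forall h : hom P (sZ S), exists g : hom P (sY S), smap2 S ∘ g = h].

Definition rel_projective (A : addCat) (E : seq3 A -> Prop) (P : A) : Prop :=
  forall S, E S -> hom_exact P S.

Section Quotient.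
Variables (A : addCat) (E : seq3 A -> Prop).
Implicit Types X Y Z : A.

Definition factors_through_proj X Y (f : hom X Y) : Prop :=
  exists (P : A) (g : hom X P) (h : hom P Y),
    rel_projective E P /\ f = h ∘ g.

Lemma rel_projective_zob : rel_projective E (zob A).
Proof.
move=> S _; split=> [f g _|g|h].
- by rewrite (zob_homl f) (zob_homl g).
- split=> _; last by rewrite (zob_homl g) ccomp0r.
  by exists 0; rewrite ccomp0r (zob_homl g).
- by exists 0; rewrite ccomp0r (zob_homl h).
Qed.

Lemma rel_projective_dsum P Q :
  rel_projective E P -> rel_projective E Q -> rel_projective E (dsum P Q).
Proof.
move=> hP hQ S ES.
have [injP exP surP] := hP S ES; have [injQ exQ surQ] := hQ S ES.
have [k11 k22 k12 k21 kD] := dsumP P Q.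
have dec Z (f : hom (dsum P Q) Z) :
    f = (f ∘ in1 P Q) ∘ pr1 P Q + (f ∘ in2 P Q) ∘ pr2 P Q.
  by rewrite -!ccompA -ccompDr kD ccomp1r.
split=> [f g fg|g|h].
- have /injP e1 : smap1 S ∘ (f ∘ in1 P Q) = smap1 S ∘ (g ∘ in1 P Q).
    by rewrite !ccompA fg.
  have /injQ e2 : smap1 S ∘ (f ∘ in2 P Q) = smap1 S ∘ (g ∘ in2 P Q).
    by rewrite !ccompA fg.
  by rewrite (dec _ f) (dec _ g) e1 e2.
- split=> [g0|[f <-]].
    have /exP[f1 f1E] : smap2 S ∘ (g ∘ in1 P Q) = 0.
      by rewrite ccompA g0 ccomp0l.
    have /exQ[f2 f2E] : smap2 S ∘ (g ∘ in2 P Q) = 0.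
      by rewrite ccompA g0 ccomp0l.
    exists (f1 ∘ pr1 P Q + f2 ∘ pr2 P Q).
    by rewrite ccompDr !ccompA f1E f2E -dec.
  rewrite (dec _ f) !ccompDr !ccompA.
  have -> : smap2 S ∘ smap1 S ∘ f ∘ in1 P Q = 0.
    by rewrite -!ccompA; apply/exP; exists (f ∘ in1 P Q).
  have -> : smap2 S ∘ smap1 S ∘ f ∘ in2 P Q = 0.
    by rewrite -!ccompA; apply/exQ; exists (f ∘ in2 P Q).
  by rewrite !ccomp0l addr0.
- have [g1 g1E] := surP (h ∘ in1 P Q); have [g2 g2E] := surQ (h ∘ in2 P Q).
  exists (g1 ∘ pr1 P Q + g2 ∘ pr2 P Q).
  by rewrite ccompDr !ccompA g1E g2E -dec.
Qed.

Definition factors_pred X Y : {pred hom X Y} :=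
  fun f => `[< factors_through_proj f >].

Lemma factors_closed X Y : zmod_closed (@factors_pred X Y).
Proof.
split=> [|f1 f2 /asboolP[P [g1 [h1 [hP ->]]]] /asboolP[Q [g2 [h2 [hQ ->]]]]].
  apply/asboolP; exists (zob A), 0, 0; rewrite ccomp0r.
  by split=> //; apply: rel_projective_zob.
apply/asboolP; exists (dsum P Q), (in1 P Q ∘ g1 + in2 P Q ∘ g2),
  (h1 ∘ pr1 P Q - h2 ∘ pr2 P Q); split; first exact: rel_projective_dsum.
have [k11 k22 k12 k21 _] := dsumP P Q.
rewrite ccompDr !ccompBl !ccompA -[h1 ∘ pr1 P Q ∘ in1 _ _]ccompA k11.
rewrite -[h2 ∘ pr2 P Q ∘ in1 _ _]ccompA k21 -[h1 ∘ pr1 P Q ∘ in2 _ _]ccompA k12.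
by rewrite -[h2 ∘ pr2 P Q ∘ in2 _ _]ccompA k22 !ccomp1r !ccomp0r !ccomp0l subr0 sub0r.
Qed.

HB.instance Definition _ X Y :=
  GRing.isZmodClosed.Build (hom X Y) (@factors_pred X Y) (@factors_closed X Y).

Definition quot_hom X Y : zmodType := Quotient.quot (@factors_pred X Y).

Local Open Scope quotient_scope.

Definition quot_cl X Y (f : hom X Y) : quot_hom X Y :=
  \pi_(Quotient.quot (@factors_pred X Y)) f.

Definition quot_rep X Y (f : quot_hom X Y) : hom X Y :=
  repr (f : Quotient.quot (@factors_pred X Y)).

Lemma quot_repK X Y (f : quot_hom X Y) : quot_cl (quot_rep f) = f.
Proof. exact: reprK. Qed.

Lemma quot_clP X Y (f g : hom X Y) :
  quot_cl f = quot_cl g <-> factors_through_proj (f - g).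
Proof.
have e := Quotient.idealrBE (@factors_pred X Y) f g.
split=> [/eqP fg|/asboolP fg]; last by apply/eqP; apply: etrans (esym e) fg.
by apply/asboolP; apply: etrans e fg.
Qed.

Lemma quot_clD X Y (f g : hom X Y) : quot_cl (f + g) = quot_cl f + quot_cl g.
Proof. by rewrite /quot_cl raddfD. Qed.

Lemma quot_cl0 X Y : quot_cl (0 : hom X Y) = 0.
Proof. by rewrite /quot_cl raddf0. Qed.

Definition quot_comp X Y Z (g : quot_hom Y Z) (f : quot_hom X Y) :
  quot_hom X Z := quot_cl (quot_rep g ∘ quot_rep f).

Lemma quot_compE X Y Z (g : hom Y Z) (f : hom X Y) :
  quot_comp (quot_cl g) (quot_cl f) = quot_cl (g ∘ f).
Proof.
have /quot_clP[P [a [b [hP gE]]]] := quot_repK (quot_cl g).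
have /quot_clP[Q [c [d [hQ fE]]]] := quot_repK (quot_cl f).
rewrite /quot_comp; set g' := quot_rep _ in gE *; set f' := quot_rep _ in fE *.
transitivity (quot_cl (g ∘ f')); apply/quot_clP.
  exists P, (a ∘ f'), b; split=> //.
  by rewrite ccompA -gE ccompBl.
exists Q, c, (g ∘ d); split=> //.
by rewrite -ccompA -fE ccompBr.
Qed.

Lemma quot_compA W X Y Z (h : quot_hom Y Z) (g : quot_hom X Y)
  (f : quot_hom W X) :
  quot_comp h (quot_comp g f) = quot_comp (quot_comp h g) f.
Proof.
rewrite -(quot_repK h) -(quot_repK g) -(quot_repK f).
by rewrite !quot_compE ccompA.
Qed.

Lemma quot_comp1l X Y (f : quot_hom X Y) : quot_comp (quot_cl (idm Y)) f = f.
Proof. by rewrite -(quot_repK f) quot_compE ccomp1l. Qed.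

Lemma quot_comp1r X Y (f : quot_hom X Y) : quot_comp f (quot_cl (idm X)) = f.
Proof. by rewrite -(quot_repK f) quot_compE ccomp1r. Qed.

Lemma quot_compDl X Y Z (g h : quot_hom Y Z) (f : quot_hom X Y) :
  quot_comp (g + h) f = quot_comp g f + quot_comp h f.
Proof.
rewrite -(quot_repK h) -(quot_repK g) -(quot_repK f).
by rewrite -quot_clD !quot_compE ccompDl quot_clD.
Qed.

Lemma quot_compDr X Y Z (h : quot_hom Y Z) (f g : quot_hom X Y) :
  quot_comp h (f + g) = quot_comp h f + quot_comp h g.
Proof.
rewrite -(quot_repK h) -(quot_repK g) -(quot_repK f).
by rewrite -quot_clD !quot_compE ccompDr quot_clD.
Qed.

Lemma quot_zobP : quot_cl (idm (zob A)) = 0.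
Proof. by rewrite zobP quot_cl0. Qed.

Lemma quot_dsumP X Y :
  [/\ quot_comp (quot_cl (pr1 X Y)) (quot_cl (in1 X Y)) = quot_cl (idm X),
      quot_comp (quot_cl (pr2 X Y)) (quot_cl (in2 X Y)) = quot_cl (idm Y),
      quot_comp (quot_cl (pr1 X Y)) (quot_cl (in2 X Y)) = 0,
      quot_comp (quot_cl (pr2 X Y)) (quot_cl (in1 X Y)) = 0
    & quot_comp (quot_cl (in1 X Y)) (quot_cl (pr1 X Y))
      + quot_comp (quot_cl (in2 X Y)) (quot_cl (pr2 X Y))
      = quot_cl (idm (dsum X Y))].
Proof.
have [k11 k22 k12 k21 kD] := dsumP X Y.
by split; rewrite !quot_compE -?quot_clD ?k11 ?k22 ?k12 ?k21 ?kD ?quot_cl0.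
Qed.

Definition quot_cat : addCat :=
  AddCat quot_compA quot_comp1l quot_comp1r quot_compDl quot_compDr
    quot_zobP quot_dsumP.

End Quotient.

Section FullSub.
Variables (A : addCat) (P : A -> Prop).
Hypotheses (P0 : P (zob A)) (PD : forall X Y : A, P X -> P Y -> P (dsum X Y)).

Definition full_sub : addCat :=
  @AddCat {X : A | P X} (fun X Y => hom (sval X) (sval Y))
    (fun X => idm (sval X)) (fun X Y Z g f => g ∘ f)
    (fun W X Y Z h g f => ccompA h g f)
    (fun X Y f => ccomp1l f) (fun X Y f => ccomp1r f)
    (fun X Y Z g h f => ccompDl g h f) (fun X Y Z h f g => ccompDr h f g)
    (exist _ (zob A) P0) (zobP A)
    (fun X Y => exist _ (dsum (sval X) (sval Y)) (PD (svalP X) (svalP Y)))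
    (fun X Y => in1 (sval X) (sval Y)) (fun X Y => in2 (sval X) (sval Y))
    (fun X Y => pr1 (sval X) (sval Y)) (fun X Y => pr2 (sval X) (sval Y))
    (fun X Y => dsumP (sval X) (sval Y)).

Definition full_incl : addFunctor full_sub A :=
  @AddFunctor full_sub A (fun X => sval X) (fun X Y f => f)
    (fun X => erefl) (fun X Y Z g f => erefl) (fun X Y f g => erefl).

End FullSub.

Record cpx (A : addCat) := Cpx {
  term :> int -> A;
  diff : forall n, hom (term n) (term (n + 1));
  diffK : forall n, diff (n + 1) ∘ diff n = 0
}.

Record chmap (A : addCat) (X Y : cpx A) := Chmap {
  cm :> forall n, hom (X n) (Y n);
  cmP : forall n, diff Y n ∘ cm n = cm (n + 1) ∘ diff X n
}.

Section CpxCat.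
Variable A : addCat.
Implicit Types W X Y Z : cpx A.

Lemma chmap_ext X Y (f g : chmap X Y) : (forall n, f n = g n) -> f = g.
Proof.
case: f g => [f fP] [g gP] /= fg.
have e : f = g by apply: functional_extensionality_dep.
by case: g / e gP {fg} => gP; rewrite (Prop_irrelevance fP gP).
Qed.

HB.instance Definition _ X Y := gen_eqMixin (chmap X Y).
HB.instance Definition _ X Y := gen_choiceMixin (chmap X Y).

Lemma ch0P X Y n :
  diff Y n ∘ (0 : hom (X n) (Y n)) = (0 : hom (X (n + 1)) (Y (n + 1))) ∘ diff X n.
Proof. by rewrite ccomp0l ccomp0r. Qed.
Definition ch0 X Y : chmap X Y := Chmap (@ch0P X Y).

Lemma chNP X Y (f : chmap X Y) n :
  diff Y n ∘ (- f n) = (- f (n + 1)) ∘ diff X n.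
Proof. by rewrite ccompNl ccompNr cmP. Qed.
Definition chN X Y (f : chmap X Y) : chmap X Y := Chmap (chNP f).

Lemma chDP X Y (f g : chmap X Y) n :
  diff Y n ∘ (f n + g n) = (f (n + 1) + g (n + 1)) ∘ diff X n.
Proof. by rewrite ccompDl ccompDr !cmP. Qed.
Definition chD X Y (f g : chmap X Y) : chmap X Y := Chmap (chDP f g).

Lemma chDA X Y : associative (@chD X Y).
Proof. by move=> f g h; apply: chmap_ext => n /=; rewrite addrA. Qed.
Lemma chDC X Y : commutative (@chD X Y).
Proof. by move=> f g; apply: chmap_ext => n /=; rewrite addrC. Qed.
Lemma ch0D X Y : left_id (ch0 X Y) (@chD X Y).
Proof. by move=> f; apply: chmap_ext => n /=; rewrite add0r. Qed.
Lemma chND X Y : left_inverse (ch0 X Y) (@chN X Y) (@chD X Y).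
Proof. by move=> f; apply: chmap_ext => n /=; rewrite addNr. Qed.

HB.instance Definition _ X Y :=
  GRing.isZmodule.Build (chmap X Y) (@chDA X Y) (@chDC X Y) (@ch0D X Y)
    (@chND X Y).

Lemma ch1P X n : diff X n ∘ idm (X n) = idm (X (n + 1)) ∘ diff X n.
Proof. by rewrite ccomp1l ccomp1r. Qed.
Definition ch1 X : chmap X X := Chmap (@ch1P X).

Lemma chMP X Y Z (g : chmap Y Z) (f : chmap X Y) n :
  diff Z n ∘ (g n ∘ f n) = (g (n + 1) ∘ f (n + 1)) ∘ diff X n.
Proof. by rewrite ccompA cmP -ccompA cmP ccompA. Qed.
Definition chM X Y Z (g : chmap Y Z) (f : chmap X Y) : chmap X Z :=
  Chmap (chMP g f).

Lemma chMA W X Y Z (h : chmap Y Z) (g : chmap X Y) (f : chmap W X) :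
  chM h (chM g f) = chM (chM h g) f.
Proof. by apply: chmap_ext => n /=; rewrite ccompA. Qed.
Lemma chM1l X Y (f : chmap X Y) : chM (ch1 Y) f = f.
Proof. by apply: chmap_ext => n /=; rewrite ccomp1l. Qed.
Lemma chM1r X Y (f : chmap X Y) : chM f (ch1 X) = f.
Proof. by apply: chmap_ext => n /=; rewrite ccomp1r. Qed.
Lemma chMDl X Y Z (g h : chmap Y Z) (f : chmap X Y) :
  chM (g + h) f = chM g f + chM h f.
Proof. by apply: chmap_ext => n /=; rewrite ccompDl. Qed.
Lemma chMDr X Y Z (h : chmap Y Z) (f g : chmap X Y) :
  chM h (f + g) = chM h f + chM h g.
Proof. by apply: chmap_ext => n /=; rewrite ccompDr. Qed.

Lemma cpx0P (n : int) : (0 : hom (zob A) (zob A)) ∘ (0 : hom (zob A) (zob A)) = 0.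
Proof. exact: ccomp0l. Qed.
Definition cpx0 : cpx A :=
  @Cpx A (fun=> zob A) (fun=> 0) cpx0P.

Lemma ch1_cpx0 : ch1 cpx0 = 0.
Proof. by apply: chmap_ext => n /=; apply: zob_homl. Qed.

Section Sum.
Variables X Y : cpx A.

Definition cpxD_term (n : int) : A := dsum (X n) (Y n).
Definition cpxD_diff n : hom (cpxD_term n) (cpxD_term (n + 1)) :=
  in1 _ _ ∘ (diff X n ∘ pr1 _ _) + in2 _ _ ∘ (diff Y n ∘ pr2 _ _).

Lemma cpxD_in1 n :
  cpxD_diff n ∘ in1 (X n) (Y n) = in1 (X (n + 1)) (Y (n + 1)) ∘ diff X n.
Proof.
have [k11 k22 k12 k21 kD] := dsumP (X n) (Y n).
by rewrite ccompDl -!ccompA k11 k21 !ccomp0r ccomp1r addr0.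
Qed.

Lemma cpxD_in2 n :
  cpxD_diff n ∘ in2 (X n) (Y n) = in2 (X (n + 1)) (Y (n + 1)) ∘ diff Y n.
Proof.
have [k11 k22 k12 k21 kD] := dsumP (X n) (Y n).
by rewrite ccompDl -!ccompA k12 k22 !ccomp0r ccomp1r add0r.
Qed.

Lemma cpxD_pr1 n :
  diff X n ∘ pr1 (X n) (Y n) = pr1 (X (n + 1)) (Y (n + 1)) ∘ cpxD_diff n.
Proof.
have [k11 k22 k12 k21 kD] := dsumP (X (n + 1)) (Y (n + 1)).
by rewrite ccompDr !ccompA k11 k12 !ccomp0l ccomp1l addr0.
Qed.

Lemma cpxD_pr2 n :
  diff Y n ∘ pr2 (X n) (Y n) = pr2 (X (n + 1)) (Y (n + 1)) ∘ cpxD_diff n.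
Proof.
have [k11 k22 k12 k21 kD] := dsumP (X (n + 1)) (Y (n + 1)).
by rewrite ccompDr !ccompA k21 k22 !ccomp0l ccomp1l add0r.
Qed.

Lemma cpxD_diffK n : cpxD_diff (n + 1) ∘ cpxD_diff n = 0.
Proof.
rewrite [in X in _ ∘ X]/cpxD_diff ccompDr !ccompA cpxD_in1 cpxD_in2.
rewrite -[in1 _ _ ∘ _ ∘ _]ccompA -[in2 _ _ ∘ _ ∘ _]ccompA !diffK.
by rewrite !ccomp0r !ccomp0l addr0.
Qed.

Definition cpxD : cpx A := Cpx cpxD_diffK.
Definition ch_in1 : chmap X cpxD := @Chmap _ X cpxD (fun=> in1 _ _) cpxD_in1.
Definition ch_in2 : chmap Y cpxD := @Chmap _ Y cpxD (fun=> in2 _ _) cpxD_in2.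
Definition ch_pr1 : chmap cpxD X := @Chmap _ cpxD X (fun=> pr1 _ _) cpxD_pr1.
Definition ch_pr2 : chmap cpxD Y := @Chmap _ cpxD Y (fun=> pr2 _ _) cpxD_pr2.

Lemma cpxDP :
  [/\ chM ch_pr1 ch_in1 = ch1 X, chM ch_pr2 ch_in2 = ch1 Y,
      chM ch_pr1 ch_in2 = 0, chM ch_pr2 ch_in1 = 0
    & chM ch_in1 ch_pr1 + chM ch_in2 ch_pr2 = ch1 cpxD].
Proof.
by split; apply: chmap_ext => n; have [? ? ? ? ?] := dsumP (X n) (Y n).
Qed.

End Sum.

Definition cpx_cat : addCat :=
  @AddCat (cpx A) (fun X Y => chmap X Y) ch1 chM chMA chM1l chM1r chMDl chMDr
    cpx0 ch1_cpx0 cpxD ch_in1 ch_in2 ch_pr1 ch_pr2 cpxDP.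

Definition term_functor (n : int) : addFunctor cpx_cat A :=
  @AddFunctor cpx_cat A (fun X => term X n) (fun X Y f => cm f n)
    (fun X => erefl) (fun X Y Z g f => erefl) (fun X Y f g => erefl).

End CpxCat.

Section CpxFunctor.
Variables (A B : addCat) (F : addFunctor A B).

Lemma cpx_map_diffK (X : cpx A) n :
  fmap F (diff X (n + 1)) ∘ fmap F (diff X n) = 0.
Proof. by rewrite -fmapM diffK fmap0. Qed.

Definition cpx_map (X : cpx A) : cpx B :=
  @Cpx B (fun n => F (X n)) (fun n => fmap F (diff X n)) (cpx_map_diffK X).

Lemma chmap_mapP (X Y : cpx A) (f : chmap X Y) n :
  diff (cpx_map Y) n ∘ fmap F (f n) = fmap F (f (n + 1)) ∘ diff (cpx_map X) n.
Proof. by rewrite /= -!fmapM cmP. Qed.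

Definition chmap_map (X Y : cpx A) (f : chmap X Y) :
  chmap (cpx_map X) (cpx_map Y) :=
  @Chmap B (cpx_map X) (cpx_map Y) (fun n => fmap F (f n)) (chmap_mapP f).

Lemma chmap_map1 (X : cpx A) : chmap_map (ch1 X) = ch1 (cpx_map X).
Proof. by apply: chmap_ext => n /=; rewrite fmap1. Qed.
Lemma chmap_mapM (X Y Z : cpx A) (g : chmap Y Z) (f : chmap X Y) :
  chmap_map (chM g f) = chM (chmap_map g) (chmap_map f).
Proof. by apply: chmap_ext => n /=; rewrite fmapM. Qed.
Lemma chmap_mapD (X Y : cpx A) (f g : chmap X Y) :
  chmap_map (f + g) = chmap_map f + chmap_map g.
Proof. by apply: chmap_ext => n /=; rewrite fmapD. Qed.

Definition cpx_functor : addFunctor (cpx_cat A) (cpx_cat B) :=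
  @AddFunctor (cpx_cat A) (cpx_cat B) cpx_map chmap_map
    chmap_map1 chmap_mapM chmap_mapD.

End CpxFunctor.

(* A left module over the group algebra kG is given by a k-module with a      *)
(* k-linear left action of G; G is the whole of [gT], and k may be zero.      *)
Record kGmod (k : comPzRingType) (gT : finGroupType) := KGmod {
  carrier :> lmodType k;
  act : gT -> carrier -> carrier;
  act_linear : forall g, linear (act g);
  act1 : forall x, act 1%g x = x;
  actM : forall g h x, act (g * h)%g x = act g (act h x)
}.

Record khom (k : comPzRingType) (gT : finGroupType) (M N : kGmod k gT) := KHom {
  khom_fun :> M -> N;
  khom_linear : linear khom_fun;
  khom_act : forall g x, khom_fun (act g x) = act g (khom_fun x)
}.

Section KGmodCat.
Variables (k : comPzRingType) (gT : finGroupType).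
Implicit Types L M N : kGmod k gT.

HB.instance Definition _ M g :=
  GRing.isLinear.Build k M M *:%R (@act _ _ M g) (@act_linear _ _ M g).
HB.instance Definition _ M N (f : khom M N) :=
  GRing.isLinear.Build k M N *:%R (khom_fun f) (khom_linear f).

Lemma khom_ext M N (f g : khom M N) : f =1 g -> f = g.
Proof.
case: f g => [f fP fQ] [g gP gQ] /= /funext fg.
case: g / fg gP gQ => gP gQ.
by rewrite (Prop_irrelevance fP gP) (Prop_irrelevance fQ gQ).
Qed.

HB.instance Definition _ M N := gen_eqMixin (khom M N).
HB.instance Definition _ M N := gen_choiceMixin (khom M N).

Lemma khom0_linear M N : linear (fun _ : M => 0 : N).
Proof. by move=> a x y; rewrite scaler0 addr0. Qed.
Lemma khom0_act M N (g : gT) (x : M) : (0 : N) = act g (0 : N).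
Proof. by rewrite raddf0. Qed.
Definition khom0 M N : khom M N := KHom (@khom0_linear M N) (@khom0_act M N).

Lemma khomN_linear M N (f : khom M N) : linear (fun x => - f x).
Proof. by move=> a x y; rewrite linearP opprD scalerN. Qed.
Lemma khomN_act M N (f : khom M N) g x : - f (act g x) = act g (- f x).
Proof. by rewrite raddfN khom_act. Qed.
Definition khomN M N (f : khom M N) : khom M N :=
  KHom (khomN_linear f) (khomN_act f).

Lemma khomD_linear M N (f g : khom M N) : linear (fun x => f x + g x).
Proof. by move=> a x y; rewrite !linearP scalerDr addrACA. Qed.
Lemma khomD_act M N (f g : khom M N) h x :
  f (act h x) + g (act h x) = act h (f x + g x).
Proof. by rewrite raddfD !khom_act. Qed.
Definition khomD M N (f g : khom M N) : khom M N :=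
  KHom (khomD_linear f g) (khomD_act f g).

Lemma khomDA M N : associative (@khomD M N).
Proof. by move=> f g h; apply: khom_ext => x /=; rewrite addrA. Qed.
Lemma khomDC M N : commutative (@khomD M N).
Proof. by move=> f g; apply: khom_ext => x /=; rewrite addrC. Qed.
Lemma khom0D M N : left_id (khom0 M N) (@khomD M N).
Proof. by move=> f; apply: khom_ext => x /=; rewrite add0r. Qed.
Lemma khomND M N : left_inverse (khom0 M N) (@khomN M N) (@khomD M N).
Proof. by move=> f; apply: khom_ext => x /=; rewrite addNr. Qed.

HB.instance Definition _ M N :=
  GRing.isZmodule.Build (khom M N) (@khomDA M N) (@khomDC M N) (@khom0D M N)
    (@khomND M N).

Lemma khom1_linear M : linear (fun x : M => x).
Proof. by []. Qed.
Definition khom1 M : khom M M := KHom (@khom1_linear M) (fun _ _ => erefl).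

Lemma khomM_linear L M N (g : khom M N) (f : khom L M) :
  linear (fun x => g (f x)).
Proof. by move=> a x y; rewrite !linearP. Qed.
Lemma khomM_act L M N (g : khom M N) (f : khom L M) h x :
  g (f (act h x)) = act h (g (f x)).
Proof. by rewrite !khom_act. Qed.
Definition khomM L M N (g : khom M N) (f : khom L M) : khom L N :=
  KHom (khomM_linear g f) (khomM_act g f).

Lemma khomMA K L M N (h : khom M N) (g : khom L M) (f : khom K L) :
  khomM h (khomM g f) = khomM (khomM h g) f.
Proof. exact: khom_ext. Qed.
Lemma khomM1l M N (f : khom M N) : khomM (khom1 N) f = f.
Proof. exact: khom_ext. Qed.
Lemma khomM1r M N (f : khom M N) : khomM f (khom1 M) = f.
Proof. exact: khom_ext. Qed.
Lemma khomMDl L M N (g h : khom M N) (f : khom L M) :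
  khomM (g + h) f = khomM g f + khomM h f.
Proof. exact: khom_ext. Qed.
Lemma khomMDr L M N (h : khom M N) (f g : khom L M) :
  khomM h (f + g) = khomM h f + khomM h g.
Proof. by apply: khom_ext => x /=; rewrite raddfD. Qed.

Lemma kG0_linear (g : gT) : linear (fun x : 'rV[k]_0 => x).
Proof. by []. Qed.
Definition kG0 : kGmod k gT :=
  @KGmod k gT 'rV[k]_0 (fun _ x => x) kG0_linear
    (fun _ => erefl) (fun _ _ _ => erefl).

Lemma khom1_kG0 : khom1 kG0 = 0.
Proof. by apply: khom_ext => x; apply/rowP => -[]. Qed.

Section Sum.
Variables M N : kGmod k gT.

Definition kGD_act (g : gT) (x : M * N) : M * N := (act g x.1, act g x.2).
Lemma kGD_linear g : linear (kGD_act g).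
Proof. by move=> a [x1 x2] [y1 y2]; rewrite /kGD_act /= !linearP. Qed.
Lemma kGD_act1 x : kGD_act 1%g x = x.
Proof. by case: x => x1 x2; rewrite /kGD_act /= !act1. Qed.
Lemma kGD_actM g h x : kGD_act (g * h)%g x = kGD_act g (kGD_act h x).
Proof. by rewrite /kGD_act /= !actM. Qed.
Definition kGD : kGmod k gT :=
  @KGmod k gT (M * N)%type kGD_act kGD_linear kGD_act1 kGD_actM.

Lemma khin1_linear : linear (fun x : M => (x, 0) : kGD).
Proof. by move=> a x y; congr (_, _) => /=; rewrite scaler0 addr0. Qed.
Lemma khin1_act g (x : M) : ((act g x, 0) : kGD) = act g ((x, 0) : kGD).
Proof. by rewrite /= /kGD_act /= raddf0. Qed.
Definition khin1 : khom M kGD := KHom khin1_linear khin1_act.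

Lemma khin2_linear : linear (fun x : N => (0, x) : kGD).
Proof. by move=> a x y; congr (_, _) => /=; rewrite scaler0 addr0. Qed.
Lemma khin2_act g (x : N) : ((0, act g x) : kGD) = act g ((0, x) : kGD).
Proof. by rewrite /= /kGD_act /= raddf0. Qed.
Definition khin2 : khom N kGD := KHom khin2_linear khin2_act.

Lemma khpr1_linear : linear (fun x : kGD => x.1).
Proof. by []. Qed.
Definition khpr1 : khom kGD M := KHom khpr1_linear (fun _ _ => erefl).
Lemma khpr2_linear : linear (fun x : kGD => x.2).
Proof. by []. Qed.
Definition khpr2 : khom kGD N := KHom khpr2_linear (fun _ _ => erefl).

Lemma kGDP :
  [/\ khomM khpr1 khin1 = khom1 M, khomM khpr2 khin2 = khom1 N,
      khomM khpr1 khin2 = 0, khomM khpr2 khin1 = 0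
    & khomM khin1 khpr1 + khomM khin2 khpr2 = khom1 kGD].
Proof.
split; apply: khom_ext => // -[x y].
by congr (_, _) => /=; rewrite ?addr0 ?add0r.
Qed.

End Sum.

Definition kG_cat : addCat :=
  @AddCat (kGmod k gT) (fun M N => khom M N) khom1 khomM khomMA khomM1l khomM1r
    khomMDl khomMDr kG0 khom1_kG0 kGD khin1 khin2 khpr1 khpr2 kGDP.

End KGmodCat.

(* A list [:: (u1, x1); ...; (ur, xr)] stands for u1 (x) x1 + ... + ur (x) xr.*)
(* The monoid so presented is a group, the inverse of u (x) x being           *)
(* (- u) (x) x; see [tens_univ] for its universal property.                   *)
Inductive tens_rel (k : comPzRingType) (U M : lmodType k) :
    seq (U * M) -> seq (U * M) -> Prop :=
| tens_refl s : tens_rel s s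
| tens_sym s t : tens_rel s t -> tens_rel t s
| tens_trans s t r : tens_rel s t -> tens_rel t r -> tens_rel s r
| tens_cat s s' t t' :
    tens_rel s s' -> tens_rel t t' -> tens_rel (s ++ t) (s' ++ t')
| tens_catC s t : tens_rel (s ++ t) (t ++ s)
| tens_add0l x : tens_rel [:: (0, x)] [::]
| tens_addl u v x : tens_rel [:: (u + v, x)] [:: (u, x); (v, x)]
| tens_addr u x y : tens_rel [:: (u, x + y)] [:: (u, x); (u, y)]
| tens_scale a u x : tens_rel [:: (a *: u, x)] [:: (u, a *: x)].

Section Tensor.
Variables (k : comPzRingType) (U M : lmodType k).

Definition tens_relb (s t : seq (U * M)) : bool := `[< tens_rel s t >].

Lemma tens_relb_equiv : equiv_class_of tens_relb.
Proof.
split=> [s|s t|t s r]; first by apply/asboolP; apply: tens_refl.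
  by apply/asboolP/asboolP; apply: tens_sym.
by move=> /asboolP st /asboolP tr; apply/asboolP; apply: tens_trans tr.
Qed.

Canonical tens_equiv := EquivRelPack tens_relb_equiv.

Definition tensor : Type := {eq_quot tens_equiv}%qT.
HB.instance Definition _ := Choice.on tensor.

Definition tcl (s : seq (U * M)) : tensor :=
  (\pi_({eq_quot tens_equiv}) s)%qT.
Definition trep (x : tensor) : seq (U * M) :=
  repr (x : {eq_quot tens_equiv}%qT).

Lemma trepK x : tcl (trep x) = x.
Proof. exact: reprK. Qed.

Lemma tclP s t : tcl s = tcl t <-> tens_rel s t.
Proof. by split=> [/eqmodP/asboolP|st]; last exact/eqmodP/asboolP. Qed.

Definition tpure (u : U) (x : M) : tensor := tcl [:: (u, x)].

Definition tzero : tensor := tcl [::].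
Definition tadd (x y : tensor) : tensor := tcl (trep x ++ trep y).
Definition topp (x : tensor) : tensor := tcl [seq (- p.1, p.2) | p <- trep x].
Definition tscale (a : k) (x : tensor) : tensor :=
  tcl [seq (a *: p.1, p.2) | p <- trep x].

Lemma taddE s t : tadd (tcl s) (tcl t) = tcl (s ++ t).
Proof. by apply/tclP; apply: tens_cat; apply/tclP; rewrite trepK. Qed.

End Tensor.

Lemma linear_morphs (k : comPzRingType) (U W : lmodType k) (f : U -> W) :
  linear f ->
  [/\ f 0 = 0, {morph f : x y / x + y}
    & forall a x, f (a *: x) = a *: f x].
Proof.
move=> lf.
have fD x y : f (x + y) = f x + f y by rewrite -[x]scale1r lf !scale1r.
have f0 : f 0 = 0 by apply: (addrI (f 0)); rewrite -fD !addr0.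
by split=> // a x; rewrite -[a *: x]addr0 lf f0 addr0.
Qed.

Section TensorMap.
Variables (k : comPzRingType) (U M U' M' : lmodType k).
Variables (f : U -> U') (g : M -> M').
Hypotheses (flin : linear f) (glin : linear g).

Let Pmap (p : U * M) := (f p.1, g p.2).

Lemma tens_rel_map s t : tens_rel s t -> tens_rel (map Pmap s) (map Pmap t).
Proof.
have [f0 fD fZ] := linear_morphs flin; have [_ gD gZ] := linear_morphs glin.
elim=> {s t} /=; rewrite /Pmap /=.
- by move=> s; apply: tens_refl.
- by move=> s t _; apply: tens_sym.
- by move=> s t r _ st _; apply: tens_trans.
- by move=> s s' t t' _ ss _ tt; rewrite !map_cat; apply: tens_cat.
- by move=> s t; rewrite !map_cat; apply: tens_catC.
- by move=> x; rewrite f0; apply: tens_add0l.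
- by move=> u v x; rewrite fD; apply: tens_addl.
- by move=> u x y; rewrite gD; apply: tens_addr.
- by move=> a u x; rewrite fZ gZ; apply: tens_scale.
Qed.

Definition tmap (x : tensor U M) : tensor U' M' := tcl (map Pmap (trep x)).

Lemma tmapE s : tmap (tcl s) = tcl [seq (f p.1, g p.2) | p <- s].
Proof. by apply/tclP; apply: tens_rel_map; apply/tclP; rewrite trepK. Qed.

End TensorMap.

Section TensorModule.
Variables (k : comPzRingType) (U M : lmodType k).
Local Notation T := (tensor U M).

Lemma scale_linear (a : k) (W : lmodType k) : linear ( *:%R a : W -> W).
Proof. by move=> b x y; rewrite scalerDr !scalerA mulrC. Qed.
Lemma idfun_linear (W : lmodType k) : linear (fun x : W => x).
Proof. by []. Qed.

Lemma tscaleE a s : tscale a (tcl s : T) = tcl [seq (a *: p.1, p.2) | p <- s].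
Proof. exact: (tmapE (scale_linear a (W := U)) (@idfun_linear M)). Qed.

Lemma opp_linear : linear (fun x : U => - x).
Proof. by move=> b x y; rewrite opprD scalerN. Qed.

Lemma toppE s : topp (tcl s : T) = tcl [seq (- p.1, p.2) | p <- s].
Proof. exact: (tmapE opp_linear (@idfun_linear M)). Qed.

Lemma taddA : associative (@tadd k U M).
Proof.
move=> x y z; rewrite -(trepK x) -(trepK y) -(trepK z).
by rewrite !taddE catA.
Qed.

Lemma taddC : commutative (@tadd k U M).
Proof.
move=> x y; rewrite -(trepK x) -(trepK y) !taddE.
by apply/tclP; apply: tens_catC.
Qed.

Lemma tadd0 : left_id (tzero U M) (@tadd k U M).
Proof. by move=> x; rewrite -(trepK x) taddE. Qed.

Lemma taddN : left_inverse (tzero U M) (@topp k U M) (@tadd k U M).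
Proof.
move=> x; rewrite -(trepK x) toppE taddE.
elim: (trep x) => [|[u y] s IHs] //=.
rewrite -[_ :: _](cat1s (- u, y) _) -[(u, y) :: s]cat1s.
have -> : [:: (- u, y)] ++ (map (fun p => (- p.1, p.2)) s) ++ [:: (u, y)] ++ s
        = ([:: (- u, y)] ++ (map (fun p => (- p.1, p.2)) s ++ [:: (u, y)])) ++ s.
  by rewrite !catA.
rewrite -taddE -taddE -[tcl (_ ++ [:: (u, y)])]taddE.
rewrite [tadd _ (tcl [:: (u, y)])]taddC -!taddA [tadd (tcl (map _ s)) _]taddE IHs.
rewrite taddA taddE taddC tadd0; apply/tclP => /=.
apply: (tens_trans (t := [:: (- u + u, y)])).
  by apply/tens_sym/tens_addl.
by rewrite addNr; apply: tens_add0l.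
Qed.

HB.instance Definition _ := GRing.isZmodule.Build T taddA taddC tadd0 taddN.

Lemma tclD s t : tcl (s ++ t) = tcl s + tcl t :> T.
Proof. by rewrite -taddE. Qed.

Lemma tcl_sum s : tcl s = \sum_(p <- s) tpure p.1 p.2 :> T.
Proof.
elim: s => [|[u x] s IHs]; first by rewrite big_nil.
by rewrite big_cons -IHs -tclD.
Qed.

Lemma tpureDl u v x : tpure (u + v) x = tpure u x + tpure v x :> T.
Proof. by rewrite -tclD; apply/tclP; apply: tens_addl. Qed.
Lemma tpureDr u x y : tpure u (x + y) = tpure u x + tpure u y :> T.
Proof. by rewrite -tclD; apply/tclP; apply: tens_addr. Qed.

Lemma tscale_additive a (x y : T) : tscale a (x + y) = tscale a x + tscale a y.
Proof.
by rewrite -(trepK x) -(trepK y) -tclD !tscaleE map_cat tclD.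
Qed.

Lemma tensor_ind (P : T -> Prop) :
  P 0 -> (forall x y, P x -> P y -> P (x + y)) ->
  (forall u x, P (tpure u x)) -> forall x, P x.
Proof.
move=> P0 PD Pp x; rewrite -(trepK x).
elim: (trep x) => [|[u y] s IHs]; first exact: P0.
by rewrite -cat1s tclD; apply: PD; [apply: Pp|apply: IHs].
Qed.

Lemma tscale_pure a u x : tscale a (tpure u x : T) = tpure (a *: u) x.
Proof. by rewrite tscaleE. Qed.

Lemma tscale0 a : tscale a (0 : T) = 0.
Proof. by rewrite [LHS](tscaleE a [::]). Qed.

Lemma tscaleA a b (x : T) : tscale a (tscale b x) = tscale (a * b) x.
Proof.
elim/tensor_ind: x => [|x y IHx IHy|u x]; first by rewrite !tscale0.
  by rewrite !tscale_additive IHx IHy.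
by rewrite !tscale_pure scalerA.
Qed.

Lemma tscale1 : left_id 1 (@tscale k U M).
Proof.
elim/tensor_ind=> [|x y IHx IHy|u x]; first by rewrite tscale0.
  by rewrite !tscale_additive IHx IHy.
by rewrite tscale_pure scale1r.
Qed.

Lemma tscaleDr : right_distributive (@tscale k U M) +%R.
Proof. by move=> a x y; apply: tscale_additive. Qed.

Lemma tscaleDl (x : T) : {morph (@tscale k U M)^~ x : a b / a + b}.
Proof.
move=> a b; elim/tensor_ind: x => [|x y IHx IHy|u x].
- by rewrite !tscale0 addr0.
- by rewrite !tscale_additive IHx IHy addrACA.
- by rewrite !tscale_pure scalerDl tpureDl.
Qed.

HB.instance Definition _ :=
  GRing.Zmodule_isLmodule.Build k T tscaleA tscale1 tscaleDr tscaleDl.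

Lemma tpureZl a u x : tpure (a *: u) x = a *: (tpure u x : T).
Proof. by rewrite -tscale_pure. Qed.

Lemma tpureZr a u x : tpure u (a *: x) = a *: (tpure u x : T).
Proof. by rewrite -tpureZl; apply/tclP/tens_sym/tens_scale. Qed.

Lemma tens_univ (W : lmodType k) (b : U -> M -> W) :
  (forall x, linear (b^~ x)) -> (forall u, linear (b u)) ->
  exists! h : T -> W, linear h /\ forall u x, h (tpure u x) = b u x.
Proof.
move=> bl br.
have b0 x : b 0 x = 0 by have [] := linear_morphs (bl x).
have bDl x u v : b (u + v) x = b u x + b v x.
  by have [_ + _] := linear_morphs (bl x); apply.
have bDr u x y : b u (x + y) = b u x + b u y.
  by have [_ + _] := linear_morphs (br u); apply.
have bZl a u x : b (a *: u) x = a *: b u x.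
  by have [_ _ +] := linear_morphs (bl x); apply.
have bZr a u x : b u (a *: x) = a *: b u x.
  by have [_ _ +] := linear_morphs (br u); apply.
pose S (s : seq (U * M)) := \sum_(p <- s) b p.1 p.2.
have SE s t : tens_rel s t -> S s = S t.
  elim=> {s t} //=; rewrite /S.
  - by move=> s t r _ -> _ ->.
  - by move=> s s' t t' _ e1 _ e2; rewrite !big_cat /= e1 e2.
  - by move=> s t; rewrite !big_cat /= addrC.
  - by move=> x; rewrite big_seq1 big_nil /= b0.
  - by move=> u v x; rewrite big_seq1 big_cons big_seq1 /= bDl.
  - by move=> u x y; rewrite big_seq1 big_cons big_seq1 /= bDr.
  - by move=> a u x; rewrite !big_seq1 /= bZl bZr.
pose h (x : T) := S (trep x).
have hE s : h (tcl s) = S s by apply: SE; apply/tclP; rewrite trepK.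
have hD x y : h (x + y) = h x + h y.
  by rewrite -(trepK x) -(trepK y) -tclD !hE /S big_cat.
have hp u x : h (tpure u x) = b u x by rewrite hE /S big_seq1.
have h0 : h 0 = 0 by rewrite (hE [::]) /S big_nil.
have hZ a x : h (a *: x) = a *: h x.
  elim/tensor_ind: x => [|x y IHx IHy|u x]; first by rewrite scaler0 h0 scaler0.
    by rewrite scalerDr !hD IHx IHy scalerDr.
  by rewrite -tpureZl !hp bZl.
exists h; split; first by split=> // a x y; rewrite hD hZ.
move=> h' [lin' hp']; apply/funext => x.
have [h'0 h'D _] := linear_morphs lin'.
elim/tensor_ind: x => [|x y IHx IHy|u x]; first by rewrite h0 h'0.
  by rewrite hD h'D IHx IHy.
by rewrite hp hp'.
Qed.

End TensorModule.

Section TensorMapTheory.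
Variables (k : comPzRingType) (U M U' M' : lmodType k).
Variables (f : U -> U') (g : M -> M').
Hypotheses (flin : linear f) (glin : linear g).

Lemma tmap_pure u x : tmap f g (tpure u x) = tpure (f u) (g x).
Proof. by rewrite tmapE. Qed.

Lemma tmap0 : tmap f g 0 = 0.
Proof. exact: (tmapE flin glin [::]). Qed.

Lemma tmapD x y : tmap f g (x + y) = tmap f g x + tmap f g y.
Proof.
by rewrite -(trepK x) -(trepK y) -tclD !tmapE // map_cat tclD.
Qed.

Lemma tmap_linear : linear (tmap f g).
Proof.
have [_ _ fZ] := linear_morphs flin.
move=> a x y; rewrite tmapD; congr (_ + _).
elim/tensor_ind: x => [|x z IHx IHz|u x].
- by rewrite scaler0 tmap0 scaler0.
- by rewrite scalerDr !tmapD IHx IHz scalerDr.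
- by rewrite -tpureZl !tmap_pure fZ tpureZl.
Qed.

End TensorMapTheory.

Section TensorKG.
Variables (k : comPzRingType) (gT : finGroupType) (V : kGmod k gT).
Implicit Types L M N : kGmod k gT.

Definition tact M (g : gT) : tensor V M -> tensor V M :=
  tmap (@act _ _ V g) (@act _ _ M g).

Lemma tact_pure M g u x :
  @tact M g (tpure u x) = tpure (act g u) (act g x).
Proof. by rewrite /tact tmap_pure //; apply: act_linear. Qed.

Lemma tact_linear M g : linear (@tact M g).
Proof. by apply: tmap_linear; apply: act_linear. Qed.

Lemma tactD M g x y : @tact M g (x + y) = tact g x + tact g y.
Proof. by rewrite /tact tmapD //; apply: act_linear. Qed.

Lemma tact0 M g : @tact M g 0 = 0.
Proof. by rewrite /tact tmap0 //; apply: act_linear. Qed.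

Lemma tact1 M x : @tact M 1%g x = x.
Proof.
elim/tensor_ind: x => [|x y IHx IHy|u x]; first exact: tact0.
  by rewrite tactD IHx IHy.
by rewrite tact_pure !act1.
Qed.

Lemma tactM M g h x : @tact M (g * h)%g x = tact g (tact h x).
Proof.
elim/tensor_ind: x => [|x y IHx IHy|u x]; first by rewrite !tact0.
  by rewrite !tactD IHx IHy.
by rewrite !tact_pure !actM.
Qed.

Definition tens_mod M : kGmod k gT :=
  @KGmod k gT (tensor V M) (@tact M) (@tact_linear M) (@tact1 M) (@tactM M).

Definition tens_fun M N (f : khom M N) : tens_mod M -> tens_mod N :=
  tmap (fun u : V => u) f.

Lemma tens_fun_pure M N (f : khom M N) u x :
  tens_fun f (tpure u x) = tpure u (f x).
Proof. by rewrite /tens_fun tmap_pure //; apply: khom_linear. Qed.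

Lemma tens_fun_linear M N (f : khom M N) : linear (tens_fun f).
Proof. by apply: tmap_linear => //; apply: khom_linear. Qed.

Lemma tens_funD M N (f : khom M N) x y :
  tens_fun f (x + y) = tens_fun f x + tens_fun f y.
Proof. by rewrite /tens_fun tmapD //; apply: khom_linear. Qed.

Lemma tens_fun0 M N (f : khom M N) : tens_fun f 0 = 0.
Proof. by rewrite /tens_fun tmap0 //; apply: khom_linear. Qed.

Lemma tens_fun_act M N (f : khom M N) g x :
  tens_fun f (act g x) = act g (tens_fun f x).
Proof.
rewrite /=; elim/tensor_ind: x => [|x y IHx IHy|u x].
- by rewrite tact0 tens_fun0 tact0.
- by rewrite tactD !tens_funD IHx IHy tactD.
- by rewrite tact_pure !tens_fun_pure tact_pure khom_act.
Qed.

Definition tens_hom M N (f : khom M N) : khom (tens_mod M) (tens_mod N) :=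
  KHom (tens_fun_linear f) (tens_fun_act f).

Lemma tens_hom1 M : tens_hom (khom1 M) = khom1 (tens_mod M).
Proof.
apply: khom_ext => x /=; elim/tensor_ind: x => [|x y IHx IHy|u x].
- exact: tens_fun0.
- by rewrite tens_funD IHx IHy.
- by rewrite tens_fun_pure.
Qed.

Lemma tens_homM L M N (g : khom M N) (f : khom L M) :
  tens_hom (khomM g f) = khomM (tens_hom g) (tens_hom f).
Proof.
apply: khom_ext => x /=; elim/tensor_ind: x => [|x y IHx IHy|u x].
- by rewrite !tens_fun0.
- by rewrite !tens_funD IHx IHy.
- by rewrite !tens_fun_pure.
Qed.

Lemma tens_homD M N (f g : khom M N) :
  tens_hom (f + g) = tens_hom f + tens_hom g.
Proof.
apply: khom_ext => x /=; elim/tensor_ind: x => [|x y IHx IHy|u x].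
- by rewrite !tens_fun0 addr0.
- by rewrite !tens_funD IHx IHy addrACA.
- by rewrite !tens_fun_pure /= tpureDr.
Qed.

Definition tens_functor : addFunctor (kG_cat k gT) (kG_cat k gT) :=
  @AddFunctor (kG_cat k gT) (kG_cat k gT) tens_mod tens_hom
    tens_hom1 tens_homM tens_homD.

End TensorKG.

Definition free_of_finite_rank (k : comPzRingType) (W : lmodType k) : Prop :=
  exists (r : nat) (b : 'I_r -> W),
    forall w, exists! c : 'rV[k]_r, w = \sum_(i < r) c 0 i *: b i.

Definition is_submod (k : comPzRingType) (gT : finGroupType) (M : kGmod k gT)
    (S : set M) : Prop :=
  [/\ S 0, forall x y, S x -> S y -> S (x + y),
      forall a x, S x -> S (a *: x) & forall g x, S x -> S (act g x)].

(* [F] is a composition series 0 = F 0 < F 1 < ... < F l = M: that the        *)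
(* quotient F (i+1) / F i is simple is stated as maximality of F i in         *)
(* F (i+1). The values of [F] beyond [l] are irrelevant.                      *)
Definition composition_series (k : comPzRingType) (gT : finGroupType)
    (M : kGmod k gT) (l : nat) (F : nat -> set M) : Prop :=
  [/\ F 0%N = [set 0]%classic, F l = setT,
      forall i, (i <= l)%N -> is_submod (F i),
      forall i, (i < l)%N -> (F i `<=` F i.+1)%classic /\ F i <> F i.+1
    & forall i (S : set M), (i < l)%N -> is_submod S ->
        (F i `<=` S)%classic -> (S `<=` F i.+1)%classic ->
        S = F i \/ S = F i.+1].

Definition finite_length (k : comPzRingType) (gT : finGroupType)
    (M : kGmod k gT) : Prop :=
  exists (l : nat) (F : nat -> set M), composition_series l F.

Section FiniteLength.
Variables (k : comPzRingType) (gT : finGroupType).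
Local Open Scope classical_set_scope.

Lemma finite_length0 : finite_length (kG0 k gT).
Proof.
have all0 (x y : kG0 k gT) : x = y by apply/rowP => -[].
exists 0%N, (fun=> setT); split=> //.
by apply/seteqP; split=> // x _; apply: all0.
Qed.

Lemma finite_lengthD (M N : kGmod k gT) :
  finite_length M -> finite_length N -> finite_length (kGD M N).
Proof.
move=> [m [F [F0 Fm Fsub Flt Fmax]]] [n [H [H0 Hn Hsub Hlt Hmax]]].
have pairD (x x' : M) (y y' : N) :
  (x, y) + (x', y') = (x + x', y + y') :> kGD M N by [].
have in1D (x y : M) : (x, 0) + (y, 0) = (x + y, 0) :> kGD M N.
  by rewrite pairD addr0.
have in1Z a (x : M) : a *: ((x, 0) : kGD M N) = (a *: x, 0).
  by congr (_, _); apply: scaler0.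
have in1A g (x : M) : act g ((x, 0) : kGD M N) = (act g x, 0).
  by congr (_, _); apply: raddf0.
have in2D (x y : N) : (0, x) + (0, y) = (0, x + y) :> kGD M N.
  by rewrite pairD addr0.
have in2Z a (x : N) : a *: ((0, x) : kGD M N) = (0, a *: x).
  by congr (_, _); apply: scaler0.
have in2A g (x : N) : act g ((0, x) : kGD M N) = (0, act g x).
  by congr (_, _); apply: raddf0.
pose FM i : set (kGD M N) := [set p | F i p.1 /\ p.2 = 0].
pose HN i : set (kGD M N) := [set p | H i p.2].
pose G i := if (i <= m)%N then FM i else HN (i - m)%N.
have Gm : FM m = HN 0%N.
  by apply/seteqP; rewrite /FM /HN Fm H0; split=> -[x y] => [[]|y0].
have GL i : (i <= m)%N -> G i = FM i by rewrite /G => ->.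
have GR i : G (m + i)%N = HN i.
  rewrite /G; case: leqP => [|_]; last by rewrite addKn.
  by rewrite -[X in (_ <= X)%N]addn0 leq_add2l leqn0 => /eqP->; rewrite addn0.
have FMsub i : (i <= m)%N -> is_submod (FM i).
  move=> /Fsub[s0 sD sZ sA]; split; first by split.
  - move=> [x y] [x' y'] [/= Fx yE] [/= Fx' y'E]; split; first exact: sD.
    by rewrite /= yE y'E addr0.
  - move=> a [x y] [/= Fx yE]; split; first exact: sZ.
    by rewrite /= yE scaler0.
  - move=> g [x y] [/= Fx yE]; split; first exact: sA.
    by rewrite /= yE raddf0.
have HNsub i : (i <= n)%N -> is_submod (HN i).
  move=> /Hsub[s0 sD sZ sA]; split; rewrite /HN //=.
  - by move=> [x y] [x' y'] /=; apply: sD.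
  - by move=> a [x y] /=; apply: sZ.
  - by move=> g [x y] /=; apply: sA.
have idx i : (i < m + n)%N ->
    (i < m)%N \/ exists2 j, (j < n)%N & i = (m + j)%N.
  move=> lti; case: (ltnP i m) => [|lemi]; first by left.
  right; exists (i - m)%N; last by rewrite subnKC.
  by rewrite ltn_subLR.
exists (m + n)%N, G; split.
- rewrite GL //; apply/seteqP; split=> -[x y]; rewrite /FM /= F0 /=.
    by case=> -> ->.
  by case=> -> ->.
- by rewrite GR; apply/seteqP; split=> // -[x y] _; rewrite /HN /= Hn.
- move=> i lei; case: (leqP i m) => [le|/ltnW le]; first by rewrite GL //; apply: FMsub.
  by rewrite -(subnKC le) GR; apply: HNsub; rewrite leq_subLR.
- move=> i /idx[lti|[j ltj ->]].
    rewrite !GL //; last exact: ltnW.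
    have [sF neF] := Flt _ lti; split=> [[x y] [/sF] //|e].
    apply: neF; apply/seteqP; split=> // x Fx.
    have : FM i.+1 (x, 0) by split.
    by rewrite -e; case.
  rewrite -addnS !GR; have [sH neH] := Hlt _ ltj; split=> [[x y] /sH //|e].
  apply: neH; apply/seteqP; split=> // x Hx.
  by have : HN j.+1 (0, x) by []; rewrite -e.
- move=> i S /idx[lti|[j ltj ->]] [s0 sD sZ sA].
    rewrite !GL //; last exact: ltnW.
    move=> leS Sle; pose S' : set M := [set x | S (x, 0)].
    have SE : S = [set p | S' p.1 /\ p.2 = 0].
      apply/seteqP; split=> -[x y] /=; last by move=> [Sx ->].
      by move=> Sx; have [_ /= y0] := Sle _ Sx; rewrite y0 in Sx *.
    have S'sub : is_submod S'.
      split=> //.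
      - by move=> x y Sx Sy; have := sD _ _ Sx Sy; rewrite in1D.
      - by move=> a x Sx; have := sZ a _ Sx; rewrite in1Z.
      - by move=> g x Sx; have := sA g _ Sx; rewrite in1A.
    have l1 : F i `<=` S' by move=> x Fx; apply: leS.
    have l2 : S' `<=` F i.+1 by move=> x /Sle[].
    have [e|e] := Fmax _ _ lti S'sub l1 l2; [left|right];
      by rewrite SE e.
  rewrite -addnS !GR => leS Sle; pose S' : set N := [set y | S (0, y)].
  have [h0 _ _ _] := Hsub _ (ltnW ltj).
  have SE : S = [set p | S' p.2].
    apply/seteqP; split=> -[x y] /= Sx.
      by have := sD _ _ (leS (- x, 0) h0) Sx; rewrite pairD addNr add0r.
    by have := sD _ _ (leS (x, 0) h0) Sx; rewrite pairD addr0 add0r.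
  have S'sub : is_submod S'.
    split=> //.
    - by move=> x y Sx Sy; have := sD _ _ Sx Sy; rewrite in2D.
    - by move=> a x Sx; have := sZ a _ Sx; rewrite in2Z.
    - by move=> g x Sx; have := sA g _ Sx; rewrite in2A.
  have l1 : H j `<=` S' by move=> x Hx; apply: leS.
  have l2 : S' `<=` H j.+1 by move=> x /Sle.
  by have [e|e] := Hmax _ _ ltj S'sub l1 l2; [left|right]; rewrite SE e.
Qed.

End FiniteLength.

Variant bdness := Unbounded | BoundedAbove | BoundedBelow | Bounded.

Section CpxFL.
Variables (k : comPzRingType) (gT : finGroupType).
Local Notation Mod := (kG_cat k gT).

Definition bounded_above (X : cpx Mod) : Prop :=
  exists N : int, forall n, N < n -> forall x : X n, x = 0.
Definition bounded_below (X : cpx Mod) : Prop :=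
  exists N : int, forall n, n < N -> forall x : X n, x = 0.

Definition has_bdness (b : bdness) (X : cpx Mod) : Prop :=
  match b with
  | Unbounded => True
  | BoundedAbove => bounded_above X
  | BoundedBelow => bounded_below X
  | Bounded => bounded_above X /\ bounded_below X
  end.

Definition in_cpxFL (b : bdness) (X : cpx_cat Mod) : Prop :=
  (forall n, finite_length (term X n)) /\ has_bdness b X.

Lemma in_cpxFL0 b : in_cpxFL b (zob (cpx_cat Mod)).
Proof.
split=> [n|]; first exact: finite_length0.
have all0 (x : kG0 k gT) : x = 0 by apply/rowP => -[].
by case: b => //=; try split; exists 0 => n _ x; apply: all0.
Qed.

Lemma in_cpxFLD b X Y :
  in_cpxFL b X -> in_cpxFL b Y -> in_cpxFL b (dsum X Y).
Proof.
move=> [lX bX] [lY bY]; split=> [n|]; first exact: finite_lengthD.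
have above : bounded_above X -> bounded_above Y -> bounded_above (cpxD X Y).
  move=> [N hN] [N' hN']; exists (Order.max N N') => n.
  rewrite Order.TotalTheory.gt_max => /andP[/hN h1 /hN' h2] [x y].
  by rewrite (h1 x) (h2 y).
have below : bounded_below X -> bounded_below Y -> bounded_below (cpxD X Y).
  move=> [N hN] [N' hN']; exists (Order.min N N') => n.
  rewrite Order.TotalTheory.lt_min => /andP[/hN h1 /hN' h2] [x y].
  by rewrite (h1 x) (h2 y).
case: b bX bY => /=; [by []|exact: above|exact: below|].
by move=> [aX bX] [aY bY]; split; [apply: above|apply: below].
Qed.

(* cpxFL(kG), cpxFL^+(kG), cpxFL^-(kG), cpxFL^b(kG), where ^+ is bounded      *)
(* above and ^- is bounded below.                                             *)
Definition cpxFL (b : bdness) : addCat :=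
  full_sub (in_cpxFL0 b) (@in_cpxFLD b).

Definition cpxFL_incl (b : bdness) : addFunctor (cpxFL b) (cpx_cat Mod) :=
  full_incl (in_cpxFL0 b) (@in_cpxFLD b).

Definition mod_exact (S : seq3 Mod) : Prop :=
  [/\ injective (smap1 S : sX S -> sY S),
      forall y : sY S, khom_fun (smap2 S) y = 0 <->
        exists x : sX S, khom_fun (smap1 S) x = y
    & forall z : sZ S, exists y : sY S, khom_fun (smap2 S) y = z].

Definition cpx_exact (S : seq3 (cpx_cat Mod)) : Prop :=
  forall n, mod_exact (seq3_map (term_functor Mod n) S).

Definition term_split (S : seq3 (cpx_cat Mod)) : Prop :=
  forall n, split_seq (seq3_map (term_functor Mod n) S).

(* V (x)_k S, for V regarded as a complex concentrated in degree 0 *)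
Definition tens_seq (V : kGmod k gT) (S : seq3 (cpx_cat Mod)) :
  seq3 (cpx_cat Mod) := seq3_map (cpx_functor (tens_functor V)) S.

Definition V_split (V : kGmod k gT) (S : seq3 (cpx_cat Mod)) : Prop :=
  split_seq (tens_seq V S).
Definition V_term_split (V : kGmod k gT) (S : seq3 (cpx_cat Mod)) : Prop :=
  term_split (tens_seq V S).
Definition ts_V_split (V : kGmod k gT) (S : seq3 (cpx_cat Mod)) : Prop :=
  term_split S /\ V_split V S.

Definition exact_class (b : bdness) (E : seq3 (cpx_cat Mod) -> Prop)
    (S : seq3 (cpxFL b)) : Prop :=
  cpx_exact (seq3_map (cpxFL_incl b) S) /\ E (seq3_map (cpxFL_incl b) S).

(* The complexes projective for the term split sequences are the contractible *)
(* ones, so this is C modulo chain homotopy.                                  *)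
Definition Kcat (b : bdness) : addCat :=
  quot_cat (@exact_class b term_split).
Definition Kcat_Vsplit (b : bdness) (V : kGmod k gT) : addCat :=
  quot_cat (@exact_class b (V_split V)).
Definition Kcat_tsVsplit (b : bdness) (V : kGmod k gT) : addCat :=
  quot_cat (@exact_class b (ts_V_split V)).
Definition Kcat_Vts (b : bdness) (V : kGmod k gT) : addCat :=
  quot_cat (@exact_class b (V_term_split V)).

End CpxFL.

Arguments cpxFL k gT b : clear implicits.
Arguments Kcat k gT b : clear implicits.

(* Main.v *)
(* Fitting's lemma in each degree gives every endomorphism f of a complex of  *)
(* finite length modules a termwise Drazin inverse s; being canonical, s is a *)
(* chain map commuting with f, s f is an idempotent of complexes, and         *)
(* q = f - f s f is locally nilpotent, so that 1 - q is invertible. If f is   *)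
(* idempotent modulo E-projectives, for any class E whatsoever, then so is q, *)
(* and an idempotent q with 1 - q invertible is zero: f is equal to s f in    *)
(* the quotient. So idempotents lift to the category of complexes, where they *)
(* split because images of idempotents inherit finite length and bounds.      *)
Require Import Defs.
From HB Require Import structures.
From mathcomp Require Import all_boot all_fingroup all_algebra.
From mathcomp Require Import boolp classical_sets.

Set Implicit Arguments.
Unset Strict Implicit.
Unset Printing Implicit Defensive.

Import Defs GRing.Theory.
Local Open Scope ring_scope.
Local Open Scope cat_scope.

(** Idempotents split for modules, hence for complexes ([kG_retract], [cpx_retract]), and a retract
    keeps finite length and bounds ([in_cpxFL_retract]). For the quotients, an idempotent class has
    to be lifted to an honest idempotent of complexes. In each degree Fitting's lemma divides the
    module into a part where [f] is bijective and a part where it is nilpotent; the projection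
    [s ∘ f] onto the first part is the lift ([cpx_drazin], [drazin_lift]). Nilpotency exponents may
    grow with the degree, so no single power of [f] need serve the whole complex. Therefore [s] is
    pinned down by a relation in which no exponent is fixed, which makes it a chain map, and
    nilpotency enters only through the invertibility of [1 - q]. The lift splits, and the quotient
    functor carries its splitting along ([quot_completions]). *)

Definition idempotents_retract (A : addCat) : Prop :=
  forall (X : A) (e : hom X X), e ∘ e = e ->
  exists (Y : A) (i : hom Y X) (p : hom X Y), p ∘ i = idm Y /\ i ∘ p = e.

(** Local nilpotency of [q = f - f s f] makes no sense in a bare additive category; it is recorded
    by a left inverse [u] of [1 - q]. *)
Definition has_drazin (A : addCat) : Prop :=
  forall (X : A) (f : hom X X), exists s u : hom X X,
    [/\ s ∘ f = f ∘ s, s ∘ f ∘ s = s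
      & u ∘ (idm X - (f - f ∘ (s ∘ f))) = idm X].

(** * Idempotents in additive categories, their quotients and complexes *)

Section Idempotents.
Variable A : addCat.

(** The retracts for [e] and for [idm X - e] are complementary summands. *)
Lemma retract_completions :
  idempotents_retract A -> has_idempotent_completions A.
Proof.
move=> rA X e ee.
have ee' : (idm X - e) ∘ (idm X - e) = idm X - e.
  by rewrite ccompBl !ccompBr !ccomp1l !ccomp1r ee subrr subr0.
have [X1 [i1 [p1 [pi1 ip1]]]] := rA X e ee.
have [X2 [i2 [p2 [pi2 ip2]]]] := rA X _ ee'.
have ei1 : e ∘ i1 = i1 by rewrite -ip1 -ccompA pi1 ccomp1r.
have ei2 : e ∘ i2 = 0.
  rewrite -[i2]ccomp1r -pi2 !ccompA -[e ∘ i2 ∘ p2]ccompA ip2.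
  by rewrite ccompBr ccomp1r ee subrr ccomp0l.
exists X1, X2, i1, i2, p1, p2; split=> //; split=> //.
- by rewrite -[p1]ccomp1l -pi1 -[p1 ∘ i1 ∘ p1]ccompA ip1 -ccompA ei2 ccomp0r.
- rewrite -[p2]ccomp1l -pi2 -[p2 ∘ i2 ∘ p2]ccompA ip2 -ccompA ccompBl ei1.
  by rewrite ccomp1l subrr ccomp0r.
- by rewrite ip1 ip2 addrC subrK.
Qed.

(** With [p = s f], both [f p] and [p f] equal [s f f], hence [p] in the quotient. So [q] becomes
    [f - p], which is idempotent there, and [q = u (1 - q) q] vanishes. *)
Lemma drazin_lift (E : seq3 A -> Prop) (X : A) (f s u : hom X X) :
  quot_cl E (f ∘ f) = quot_cl E f ->
  s ∘ f = f ∘ s -> s ∘ f ∘ s = s ->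
  u ∘ (idm X - (f - f ∘ (s ∘ f))) = idm X ->
  quot_cl E f = quot_cl E (s ∘ f).
Proof.
move=> ff sf sfs uq; pose p := s ∘ f; pose q := f - f ∘ p.
have clM (g h : hom X X) :
    quot_cl E (g ∘ h) = quot_comp (quot_cl E g) (quot_cl E h).
  by rewrite quot_compE.
have clB (g h : hom X X) : quot_cl E (g - h) = quot_cl E g - quot_cl E h.
  by apply/eqP; rewrite eq_sym subr_eq -quot_clD subrK.
have pp : p ∘ p = p by rewrite /p ccompA sfs.
have pfE : p ∘ f = s ∘ (f ∘ f) by rewrite /p -ccompA.
have fpE : f ∘ p = s ∘ (f ∘ f) by rewrite /p ccompA -sf -ccompA.
have pf : quot_cl E (p ∘ f) = quot_cl E p by rewrite pfE clM ff -clM.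
have fp : quot_cl E (f ∘ p) = quot_cl E p by rewrite fpE clM ff -clM.
have clq : quot_cl E q = quot_cl E (f - p) by rewrite /q !clB fp.
have qq : quot_cl E (q ∘ q) = quot_cl E q.
  rewrite clM clq -clM ccompBl !ccompBr pp !clB ff fp pf.
  by rewrite subrr subr0.
have q0 : quot_cl E ((idm X - q) ∘ q) = 0.
  by rewrite ccompBl ccomp1l clB qq subrr.
have : quot_cl E q = 0.
  rewrite -[q]ccomp1l -uq -ccompA clM q0.
  exact: (@ccomp0r (quot_cat E)).
by rewrite clq clB => /eqP; rewrite subr_eq0 => /eqP.
Qed.

Lemma quot_completions (E : seq3 A -> Prop) :
  has_idempotent_completions A -> has_drazin A ->
  has_idempotent_completions (quot_cat E).
Proof.
move=> iA dA X e; rewrite -(quot_repK e) /= quot_compE => ee.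
have [s [u [sf sfs uq]]] := dA X (quot_rep e).
rewrite (drazin_lift ee sf sfs uq); set p := s ∘ _.
have pp : p ∘ p = p by rewrite /p ccompA sfs.
have [X1 [X2 [i1 [i2 [p1 [p2 [[a b c d g] ei1 ei2]]]]]]] := iA X p pp.
exists X1, X2, (quot_cl E i1), (quot_cl E i2), (quot_cl E p1), (quot_cl E p2).
split; first split=> /=; rewrite /= ?quot_compE -?quot_clD.
- by rewrite a.
- by rewrite b.
- by rewrite c quot_cl0.
- by rewrite d quot_cl0.
- by rewrite g.
- by rewrite ei1.
- by rewrite ei2 quot_cl0.
Qed.

(** The retracts may be chosen independently in each degree: since [e] commutes with the
    differential, [p d i] is a differential on the images. *)
Lemma cpx_retract : idempotents_retract A -> idempotents_retract (cpx_cat A).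
Proof.
move=> rA X e ee.
have een n : cm e n ∘ cm e n = cm e n := congr1 (fun h : chmap X X => cm h n) ee.
pose cY n := cid (rA _ _ (een n)); pose Y n : A := sval (cY n).
pose ci n := cid (svalP (cY n)); pose i n : hom (Y n) (term X n) := sval (ci n).
pose cp n := cid (svalP (ci n)); pose p n : hom (term X n) (Y n) := sval (cp n).
have pi n : p n ∘ i n = idm (Y n) := (svalP (cp n)).1.
have ip n : i n ∘ p n = cm e n := (svalP (cp n)).2.
have pe n : p n ∘ cm e n = p n by rewrite -ip ccompA pi ccomp1l.
have ei n : cm e n ∘ i n = i n by rewrite -ip -ccompA pi ccomp1r.
pose d n := p (n + 1) ∘ diff X n ∘ i n.
have dK n : d (n + 1) ∘ d n = 0.
  rewrite /d -!ccompA [i (n + 1) ∘ _]ccompA ip [cm e _ ∘ _]ccompA -cmP.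
  by rewrite -ccompA ei [diff X (n + 1) ∘ _]ccompA diffK ccomp0l ccomp0r.
pose Z := Cpx dK.
have iP n : diff X n ∘ i n = i (n + 1) ∘ diff Z n.
  by rewrite /= /d !ccompA ip -cmP -ccompA ei.
have pP n : diff Z n ∘ p n = p (n + 1) ∘ diff X n.
  by rewrite /= /d -[_ ∘ i n ∘ p n]ccompA ip -ccompA cmP ccompA pe.
exists Z, (@Chmap _ Z X i iP), (@Chmap _ X Z p pP).
by split; apply: chmap_ext => n /=.
Qed.

End Idempotents.

Section Modules.
Variables (k : comPzRingType) (gT : finGroupType).
Implicit Types M N : kGmod k gT.

(** * The image of an idempotent of modules, realised as its fixed points *)

Section FixedPoints.
Variables (M : kGmod k gT) (e : khom M M).

Definition fixed_pred : {pred M} := fun x => khom_fun e x == x.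

Lemma fixed_closed : submod_closed fixed_pred.
Proof.
split=> [|a x y /eqP ex /eqP ey]; apply/eqP; first exact: raddf0.
by rewrite linearP /= ex ey.
Qed.

HB.instance Definition _ :=
  GRing.isSubmodClosed.Build k M fixed_pred fixed_closed.

Definition fixed_type : Type := {x : M | fixed_pred x}.
HB.instance Definition _ := SubChoice.on fixed_type.
HB.instance Definition _ := [SubChoice_isSubLmodule of fixed_type by <:].

Lemma fixed_val (x : fixed_type) : khom_fun e (val x) = val x.
Proof. exact/eqP/(valP x). Qed.

Lemma fixed_act_subproof g (x : fixed_type) : fixed_pred (act g (val x)).
Proof. by apply/eqP; rewrite khom_act fixed_val. Qed.

Definition fixed_act g (x : fixed_type) : fixed_type :=
  Sub (act g (val x)) (fixed_act_subproof g x).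

Lemma fixed_act_linear g : linear (fixed_act g).
Proof.
by move=> a x y; apply: val_inj; rewrite linearP !SubK !linearP.
Qed.

Lemma fixed_act1 x : fixed_act 1%g x = x.
Proof. by apply: val_inj; rewrite SubK act1. Qed.

Lemma fixed_actM g h x : fixed_act (g * h)%g x = fixed_act g (fixed_act h x).
Proof. by apply: val_inj; rewrite !SubK actM. Qed.

Definition fixed_mod : kGmod k gT :=
  @KGmod k gT fixed_type fixed_act fixed_act_linear fixed_act1 fixed_actM.

End FixedPoints.

Lemma kG_retract : idempotents_retract (kG_cat k gT).
Proof.
move=> M e ee; have eK x : fixed_pred e (e x).
  by apply/eqP; rewrite -[in RHS]ee.
pose i (x : fixed_mod e) : M := val (x : fixed_type e).
pose p (x : M) : fixed_mod e := Sub (e x) (eK x).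
have il : linear i by move=> a x y; rewrite /i linearP.
have pl : linear p.
  by move=> a x y; apply: val_inj; rewrite linearP !SubK linearP.
have ia g x : i (act g x) = act g (i x) by rewrite /i SubK.
have pa g x : p (act g x) = act g (p x).
  by apply: val_inj; rewrite /= khom_act.
exists (fixed_mod e), (KHom il ia), (KHom pl pa); split; apply: khom_ext => x //=.
by apply: val_inj; rewrite SubK /i fixed_val.
Qed.

(** * Finite length through rank functions on submodules *)

Local Open Scope classical_set_scope.

(* Used in place of composition series, because it restricts to submodules.   *)
Definition submod_rank M (r : set M -> nat) : Prop :=
  forall S T : set M, is_submod S -> is_submod T -> S `<=` T -> S <> T ->
    (r S < r T)%N.

Lemma submodN M (S : set M) x : is_submod S -> S x -> S (- x).
Proof. by move=> [_ _ sZ _] Sx; rewrite -scaleN1r; apply: sZ. Qed.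

Lemma submodB M (S : set M) x y : is_submod S -> S x -> S y -> S (x - y).
Proof. by move=> sS Sx /(submodN sS); have [_ sD _ _] := sS; apply: sD. Qed.

Lemma submod_setT M : is_submod (setT : set M).
Proof. by []. Qed.

Lemma submod_set0 M : is_submod ([set 0] : set M).
Proof.
split=> //= [x y -> ->|a x ->|g x ->]; [exact: addr0|exact: scaler0|].
exact: raddf0.
Qed.

Lemma submodI M (S T : set M) : is_submod S -> is_submod T -> is_submod (S `&` T).
Proof.
move=> [s0 sD sZ sA] [t0 tD tZ tA]; split=> //.
- by move=> x y [Sx Tx] [Sy Ty]; split; [apply: sD|apply: tD].
- by move=> a x [Sx Tx]; split; [apply: sZ|apply: tZ].
- by move=> a x [Sx Tx]; split; [apply: sA|apply: tA].
Qed.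

Lemma submod_add M (S T : set M) : is_submod S -> is_submod T ->
  is_submod [set z | exists x y, [/\ S x, T y & z = x + y]].
Proof.
move=> [s0 sD sZ sA] [t0 tD tZ tA]; split=> /=.
- by exists 0, 0; rewrite addr0.
- move=> _ _ [x [y [Sx Ty ->]]] [x' [y' [Sx' Ty' ->]]].
  by exists (x + x'), (y + y'); rewrite addrACA; split; [apply: sD|apply: tD|].
- move=> a _ [x [y [Sx Ty ->]]]; exists (a *: x), (a *: y).
  by rewrite scalerDr; split; [apply: sZ|apply: tZ|].
- move=> a _ [x [y [Sx Ty ->]]]; exists (act a x), (act a y).
  by rewrite raddfD; split; [apply: sA|apply: tA|].
Qed.

Lemma submod_image M N (f : khom M N) (S : set M) :
  is_submod S -> is_submod ((f : M -> N) @` S).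
Proof.
move=> [s0 sD sZ sA]; split.
- by exists 0 => //; apply: raddf0.
- move=> _ _ [x Sx <-] [y Sy <-]; exists (x + y); first exact: sD.
  exact: raddfD.
- move=> a _ [x Sx <-]; exists (a *: x); first exact: sZ.
  by rewrite linearZ.
- move=> g _ [x Sx <-]; exists (act g x); first exact: sA.
  exact: khom_act.
Qed.

Lemma submod_ker M N (f : khom M N) : is_submod [set x | khom_fun f x = 0].
Proof.
split=> /= [|x y fx fy|a x fx|g x fx].
- exact: raddf0.
- by rewrite raddfD /= fx fy addr0.
- by rewrite linearZ /= fx scaler0.
- by rewrite khom_act fx raddf0.
Qed.

(* The rank of S is the number of steps F i < F (i+1) of a composition series *)
(* met by S, i.e. such that S contains an element of F (i+1) outside F i.     *)
Lemma finite_length_rank M :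
  finite_length M -> exists r : set M -> nat, submod_rank r.
Proof.
move=> [l [F [F0 Fl Fsub Flt Fmax]]].
pose J (S : set M) i := `[< exists x, [/\ S x, F i.+1 x & ~ F i x] >].
exists (fun S => \sum_(i < l) J S i)%N => S T sS sT ST neST.
have JST i : (J S i <= J T i ?= iff (J S i == J T i :> nat))%N.
  apply: leqif_eq; case JS: (J S i) => //; move: JS => /asboolP[x [Sx Fx nFx]].
  by rewrite lt0b; apply/asboolP; exists x; split=> //; apply: ST.
(* Equal sums force equal summands, so it suffices that [S] and [T] coincide when they meet the same
   steps. *)
rewrite ltn_neqAle (leqif_sum (fun i : 'I_l => fun=> JST i)).2.
rewrite (leqif_sum (fun i : 'I_l => fun=> JST i)).1 andbT.
apply/negP => /forallP/= eJ; apply: neST; apply/seteqP; split=> //.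
suff TS i : (i <= l)%N -> forall x, F i x -> T x -> S x.
  by move=> x Tx; apply: (TS l) => //; rewrite Fl.
elim: i => [_ x|i IHi lti x Fx Tx]; first by rewrite F0 => /= -> _; have [] := sS.
have {}IHi := IHi (ltnW lti).
case: (pselect (F i x)) => [Fix|nFix]; first exact: IHi.
have : J T i by apply/asboolP; exists x.
have /eqP eJi := eJ (Ordinal lti); rewrite -[J T i]lt0b -eJi lt0b => /asboolP[s [Ss Fs nFs]].
have sFi := Fsub i (ltnW lti); have sFi1 := Fsub i.+1 lti.
(* [U] contains [s] outside [F i], so by maximality it is all of [F i.+1]. Thus [x] is an element of
   [S] plus one of [F i], and the latter lies in [T], where induction applies. *)
pose U := [set z | exists x y, [/\ (S `&` F i.+1) x, F i y & z = x + y]].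
have sU : is_submod U by apply: submod_add => //; apply: submodI.
have [S0 _ _ _] := sS; have [F00 _ _ _] := sFi; have [F10 _ _ _] := sFi1.
have FU : F i `<=` U by move=> y Fy; exists 0, y; rewrite add0r.
have UF : U `<=` F i.+1.
  move=> _ [y [z [[_ Fy] Fz ->]]]; have [_ sD _ _] := sFi1; apply: sD => //.
  by have [+ _] := Flt i lti; apply.
have [UE|UE] := Fmax i U lti sU FU UF.
  by case: nFs; rewrite -UE; exists s, 0; rewrite addr0.
have : U x by rewrite UE.
move=> [y [z [[Sy _] Fz xE]]]; rewrite xE.
have [_ sD _ _] := sS; apply: sD => //; apply: IHi => //.
have -> : z = x - y by rewrite xE addrC addKr.
by apply: submodB => //; apply: ST.
Qed.

(** Among the proper submodules of [S], one of largest rank is maximal; a composition series of it,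
    available by induction on the rank, extends by [S]. *)
Lemma rank_finite_length M (r : set M -> nat) : submod_rank r -> finite_length M.
Proof.
move=> rS.
suff H n : forall S : set M, is_submod S -> (r S <= n)%N ->
    exists (l : nat) (F : nat -> set M),
    [/\ F 0%N = [set 0]%classic, F l = S,
      forall i, (i <= l)%N -> is_submod (F i),
      forall i, (i < l)%N -> (F i `<=` F i.+1)%classic /\ F i <> F i.+1
    & forall i (U : set M), (i < l)%N -> is_submod U ->
        (F i `<=` U)%classic -> (U `<=` F i.+1)%classic ->
        U = F i \/ U = F i.+1].
  exact: (H _ _ (submod_setT M) (leqnn _)).
elim: n => [|n IHn] S sS; rewrite ?leqn0 => rSn.
  exists 0%N, (fun=> [set 0]); split=> //; last by move=> i _; apply: submod_set0.
  apply: contrapT => neS; have: (r [set 0%R] < r S)%N; last by rewrite (eqP rSn).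
  by apply: rS => //; [exact: submod_set0|move=> x /= ->; case: sS].
have [S0|S0] := pselect ([set 0] = S).
  by exists 0%N, (fun=> [set 0]); split=> // i _; apply: submod_set0.
pose P m := `[< exists T, [/\ is_submod T, T `<=` S, T <> S & r T = m] >].
have exP : exists m, P m.
  exists (r [set 0]); apply/asboolP; exists [set 0]; split=> //.
    exact: submod_set0.
  by move=> x /= ->; case: sS.
have ubP m : P m -> (m <= n)%N.
  move=> /asboolP[T [sT TS neT <-]].
  by rewrite -ltnS; apply: leq_trans rSn; apply: rS.
case: (ex_maxnP exP ubP) => m /asboolP[T [sT TS neT rT]] maxm.
have rTn : (r T <= n)%N by apply: ubP; apply/asboolP; exists T.
have [l [F [F0 Fl Fsub Flt Fmax]]] := IHn T sT rTn.
exists l.+1, (fun i => if (i <= l)%N then F i else S); split=> //.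
- by rewrite ltnn.
- by move=> i _; case: ifP => // /Fsub.
- move=> i; rewrite ltnS => le_il; rewrite le_il; case: ltnP => [|le_li].
    exact: Flt.
  by rewrite (@anti_leq i l) ?le_il // Fl.
- move=> i U; rewrite ltnS => le_il sU; rewrite le_il.
  case: ltnP => [lt_il|le_li]; first exact: Fmax.
  rewrite (@anti_leq i l) ?le_il // Fl => TU US.
  have [|neU] := pselect (U = S); first by right.
  left; apply: contrapT => /nesym neTU.
  have := rS _ _ sT sU TU neTU; rewrite ltnNge rT maxm //.
  by apply/asboolP; exists U.
Qed.

(** Taking images along [i] is strictly monotone on submodules, so a rank on [M] pulls back to
    [N]. *)
Lemma finite_length_inj M N (i : khom N M) :
  injective i -> finite_length M -> finite_length N.
Proof.
move=> inji /finite_length_rank[r rS].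
apply: (@rank_finite_length N (fun S => r ((i : N -> M) @` S))).
move=> S T sS sT ST neST; apply: rS; try exact: submod_image.
  by move=> _ [x /ST Tx <-]; exists x.
move=> e; apply: neST; apply/seteqP; split=> // x Tx.
have : (((i : N -> M) @` S)) (i x) by rewrite e; exists x.
by move=> [y Sy /inji <-].
Qed.

(** A member of largest rank ends an ascending chain, one of smallest rank a descending chain. *)
Lemma chain_stable M (C : nat -> set M) :
  finite_length M -> (forall m, is_submod (C m)) ->
  ((forall m n, (m <= n)%N -> C m `<=` C n) ->
     exists n, forall m, C m `<=` C n)
  /\ ((forall m n, (m <= n)%N -> C n `<=` C m) ->
     exists n, forall m, C n `<=` C m).
Proof.
move=> /finite_length_rank[r rS] sC.
pose P v := `[< exists m, r (C m) = v >].
have exP : exists v, P v by exists (r (C 0%N)); apply/asboolP; exists 0%N.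
split=> mC.
  have ubP v : P v -> (v <= r setT)%N.
    move=> /asboolP[m <-]; have [->//|neT] := pselect (C m = setT).
    by apply/ltnW/rS.
  case: (ex_maxnP exP ubP) => v /asboolP[n rn] maxv; exists n => m.
  have [e|ne] := pselect (C n = C (maxn n m)); first by rewrite e; apply/mC/leq_maxr.
  have := rS _ _ (sC _) (sC _) (mC _ _ (leq_maxl n m)) ne.
  by rewrite rn ltnNge maxv //; apply/asboolP; exists (maxn n m).
case: (ex_minnP exP) => v /asboolP[n rn] minv; exists n => m.
have [<-|ne] := pselect (C (maxn n m) = C n); first exact/mC/leq_maxr.
have := rS _ _ (sC _) (sC _) (mC _ _ (leq_maxl n m)) ne.
by rewrite rn ltnNge minv //; apply/asboolP; exists (maxn n m).
Qed.

(** * Powers of an endomorphism and Fitting's lemma *)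

Fixpoint kpow M (f : khom M M) (m : nat) : khom M M :=
  if m is m'.+1 then khomM f (kpow f m') else khom1 M.

Lemma kpow_morph M N (f : khom M M) (g : khom N N) (h : khom M N) m x :
  (forall y, h (f y) = g (h y)) -> h (kpow f m x) = kpow g m (h x).
Proof. by move=> hf; elim: m => //= m <-. Qed.

Lemma kpowSr M (f : khom M M) m x : kpow f m.+1 x = kpow f m (f x).
Proof. exact: (kpow_morph (h := f)). Qed.

Lemma kpowD M (f : khom M M) m n x : kpow f (m + n)%N x = kpow f m (kpow f n x).
Proof. by elim: m => //= m ->. Qed.

Lemma kpow_ker_stable M (f : khom M M) : finite_length M ->
  exists n, forall m x, kpow f m x = 0 -> kpow f n x = 0.
Proof.
move=> flM.
have [+ _] := chain_stable flM (fun m => submod_ker (kpow f m)).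
case=> [m n le_mn x /= fx|n Hn]; last by exists n.
by rewrite -(subnK le_mn) kpowD fx raddf0.
Qed.

Lemma kpow_im_stable M (f : khom M M) : finite_length M ->
  exists n, forall m x, exists z, kpow f n x = kpow f m z.
Proof.
move=> flM.
have [_ +] := chain_stable flM (fun m => submod_image (kpow f m) (submod_setT M)).
case=> [m n le_mn _ [x _ <-]|n Hn].
  by exists (kpow f (n - m) x) => //; rewrite -kpowD subnKC.
exists n => m x.
have [|z _ <-] := Hn m (kpow f n x); first by exists x.
by exists z.
Qed.

(** The geometric series of [q] is finite at each [x]: if [y] solves the equation for [q x], then
    [x + y] solves it for [x]. A [y] fixed by [q] is fixed by all its powers, hence zero. *)
Lemma locally_nilpotent_bij M (q : khom M M) :
  (forall x, exists m, kpow q m x = 0) ->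
  (forall x, exists y, y - q y = x) /\ (forall y, y - q y = 0 -> y = 0).
Proof.
move=> nq; split=> [x|y /eqP].
  have [m] := nq x; elim: m x => [|m IHm] x.
    by move=> /= ->; exists 0; rewrite raddf0 subrr.
  rewrite kpowSr => /IHm[y yE]; exists (x + y).
  by rewrite raddfD /= opprD addrACA yE subrK.
rewrite subr_eq0 => /eqP yE; have [m <-] := nq y.
by elim: m => //= m <-.
Qed.

(** * The Drazin inverse as a chain map *)

Local Notation Mod := (kG_cat k gT).

(** Linearity and the condition at 0 make [R] single-valued, so any choice of values is
    automatically linear, equivariant and compatible with differentials. It yields both [s] and [u]
    in [cpx_drazin]. *)
Lemma chmap_of_rel (X Y : cpx Mod) (R : forall n, X n -> Y n -> Prop) :
  (forall n x, exists y, @R n x y) ->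
  (forall n y, @R n 0 y -> y = 0) ->
  (forall n a x x' y y',
     @R n x y -> @R n x' y' -> @R n (a *: x + x') (a *: y + y')) ->
  (forall n g x y, @R n x y -> @R n (act g x) (act g y)) ->
  (forall n x y, @R n x y ->
     @R (n + 1) (khom_fun (diff X n) x) (khom_fun (diff Y n) y)) ->
  exists h : chmap X Y, forall n x y, @R n x y <-> khom_fun (h n) x = y.
Proof.
move=> Rtot R0 Rlin Ract Rdiff.
have Runiq n x y y' : @R n x y -> @R n x y' -> y = y'.
  move=> Rxy Rxy'; have := Rlin n (-1) _ _ _ _ Rxy' Rxy.
  by rewrite !scaleN1r addNr => /R0; rewrite addrC => /eqP; rewrite subr_eq0 => /eqP.
pose h n x := sval (cid (Rtot n x)).
have hR n x : @R n x (h n x) := svalP (cid (Rtot n x)).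
have hl n : linear (h n).
  by move=> a x y; apply: Runiq (hR _ _) _; apply: Rlin.
have ha n g x : h n (act g x) = act g (h n x).
  by apply: Runiq (hR _ _) _; apply: Ract.
pose hh n : @hom Mod (X n) (Y n) := KHom (@hl n) (@ha n).
have hd n : diff Y n ∘ hh n = hh (n + 1) ∘ diff X n.
  apply: khom_ext => x; apply: (Runiq _ (khom_fun (diff X n) x)) (hR _ _).
  exact/Rdiff/hR.
exists (Chmap hd) => n x y; split=> [Rxy|<-]; last exact: hR.
exact: Runiq (hR _ _) Rxy.
Qed.

(* This is [s x = y] for the Drazin inverse s of f. No stabilisation index    *)
(* occurs in it, so maps commuting with f preserve it even when the Fitting   *)
(* decompositions of source and target stabilise at different powers.         *)
Definition drazin_rel M (f : khom M M) (x y : M) : Prop :=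
  (forall m, exists z, y = kpow f m z) /\
  (exists m, kpow f m.+1 y = kpow f m x).

Lemma drazin_rel_total M (f : khom M M) x :
  finite_length M -> exists y, drazin_rel f x y.
Proof.
move=> /(kpow_im_stable f)[n Hn].
(* The exponent leaves [f^(n+1)] to cancel and [f^n] to put [y] in the stable image. *)
have [z zE] := Hn (n.+1 + n)%N x; exists (kpow f n z); split=> //.
by exists n; rewrite zE kpowD.
Qed.

(** The stable image of [f] meets its stable kernel only in 0. *)
Lemma drazin_rel0 M (f : khom M M) y :
  finite_length M -> drazin_rel f 0 y -> y = 0.
Proof.
move=> /(kpow_ker_stable f)[n Hn] [imy [m]].
have [z ->] := imy n; rewrite raddf0 -kpowD => /Hn; exact.
Qed.

Lemma drazin_rel_linear M (f : khom M M) a x x' y y' :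
  drazin_rel f x y -> drazin_rel f x' y' ->
  drazin_rel f (a *: x + x') (a *: y + y').
Proof.
move=> [imy [m my]] [imy' [m' my']]; split=> [j|].
  have [z ->] := imy j; have [z' ->] := imy' j.
  by exists (a *: z + z'); rewrite linearP.
exists (m + m')%N; rewrite -addnS !khom_linear [in X in _ + X]kpowD my' -kpowD addnS.
congr (_ *: _ + _).
by rewrite [(m + m')%N]addnC -addnS kpowD my -kpowD.
Qed.

Lemma drazin_rel_morph M N (f : khom M M) (g : khom N N) (h : khom M N) x y :
  (forall z, h (f z) = g (h z)) -> drazin_rel f x y ->
  drazin_rel g (h x) (h y).
Proof.
move=> hf [imy [m my]]; split=> [j|].
  by have [z ->] := imy j; exists (h z); apply: kpow_morph.
by exists m; rewrite -!(kpow_morph _ _ hf) my.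
Qed.

Lemma drazin_rel_act M (f : khom M M) g x y :
  drazin_rel f x y -> drazin_rel f (act g x) (act g y).
Proof.
move=> [imy [m my]]; split=> [j|].
  by have [z ->] := imy j; exists (act g z); rewrite khom_act.
by exists m; rewrite !khom_act my.
Qed.

Lemma cpx_drazin (X : cpx_cat Mod) (f : hom X X) :
  (forall n, finite_length (term X n)) ->
  exists s u : hom X X,
    [/\ s ∘ f = f ∘ s, s ∘ f ∘ s = s
      & u ∘ (idm X - (f - f ∘ (s ∘ f))) = idm X].
Proof.
move=> flX; pose F n : khom (term X n) (term X n) := cm f n.
have Fd n x : khom_fun (diff X n) (F n x) = F (n + 1) (khom_fun (diff X n) x).
  by have /(congr1 (fun h : khom _ _ => h x)) := cmP f n.
have [s sP] : exists s : chmap X X, forall n x y,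
    drazin_rel (F n) x y <-> khom_fun (s n) x = y.
  apply: (@chmap_of_rel X X (fun n => drazin_rel (F n))).
  - by move=> n x; apply: drazin_rel_total.
  - by move=> n y; apply: drazin_rel0.
  - by move=> n a x x' y y'; apply: drazin_rel_linear.
  - by move=> n g x y; apply: drazin_rel_act.
  - by move=> n x y; apply: drazin_rel_morph => z; apply: Fd.
pose S n : khom (term X n) (term X n) := cm s n.
have SR n x : drazin_rel (F n) x (S n x) by apply/sP.
have SF n x : S n (F n x) = F n (S n x).
  by apply/sP; apply: drazin_rel_morph (SR n x).
have SFS n x : S n (F n (S n x)) = S n x.
  (* For [y = s x] the pair [(f y, y)] satisfies the relation with exponent 0, so [s (f y) = y]. *)
  by apply/sP; have [imS _] := SR n x; split=> //; exists 0%N.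
pose p n := khomM (S n) (F n).
have pw n x : p n (x - p n x) = 0.
  by rewrite raddfB /= SFS subrr.
have pF n x : p n (F n x) = F n (p n x) by rewrite /= SF.
pose Q : hom X X := (f : hom X X) - f ∘ ((s : hom X X) ∘ f).
pose q n : khom (term X n) (term X n) := cm Q n.
have qE n x : q n x = F n (x - p n x) by rewrite raddfB.
have nq n x : exists m, kpow (q n) m x = 0.
  (* At [F n x] the relation says that [f^(m+1)] agrees on [p x] and [x], so it kills [x - p x]. As
     [p] commutes with [f] and kills [x - p x], powers of [q] at [x] are powers of [f] at
     [x - p x]. *)
  have [_ [m mE]] := SR n (F n x); exists m.+1.
  have qm j : kpow (q n) j.+1 x = kpow (F n) j.+1 (x - p n x).
    elim: j => [|j IHj]; first exact: qE.
    have -> : kpow (q n) j.+2 x = q n (kpow (q n) j.+1 x) by [].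
    rewrite IHj qE.
    by rewrite (kpow_morph _ _ (pF n)) pw raddf0 subr0.
  have -> : kpow (q n) m.+1 x = kpow (F n) m.+1 x - kpow (F n) m.+1 (p n x).
    by rewrite qm; apply: raddfB.
  by rewrite [in X in X - _]kpowSr -mE subrr.
have qbij n := locally_nilpotent_bij (nq n).
have [u uP] : exists u : chmap X X, forall n x y,
    y - q n y = x <-> khom_fun (u n) x = y.
  apply: (@chmap_of_rel X X (fun n x y => y - q n y = x)).
  - by move=> n; apply: (qbij n).1.
  - by move=> n; apply: (qbij n).2.
  - move=> n a x x' y y' <- <-.
    by rewrite linearP /= opprD addrACA -scalerBr.
  - by move=> n g x y <-; rewrite (khom_act (q n)) [RHS]raddfB.
  - move=> n x y <-; rewrite [RHS]raddfB; congr (_ - _).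
    by have /(congr1 (fun h : khom _ _ => h y)) := cmP Q n.
exists s, u; split; apply: chmap_ext => n; apply: khom_ext => x.
- exact: SF.
- exact: SFS.
- exact/uP.
Qed.

(** * Passage to the categories [cpxFL] and conclusion *)

Lemma cpxFL_drazin b : has_drazin (cpxFL k gT b).
Proof. by move=> X f; apply: (@cpx_drazin (sval X) f) => n; apply: (svalP X).1. Qed.

Lemma in_cpxFL_retract b (X Z : cpx_cat Mod) (i : hom Z X) (p : hom X Z) :
  p ∘ i = idm Z -> in_cpxFL b X -> in_cpxFL b Z.
Proof.
move=> pi [flX bX].
have iK n : cancel (khom_fun (cm i n)) (khom_fun (cm p n)).
  by move=> x; have /(congr1 (fun h : chmap Z Z => khom_fun (cm h n) x)) := pi.
split=> [n|]; first exact: finite_length_inj (can_inj (iK n)) (flX n).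
have Z0 n : (forall x : term X n, x = 0) -> forall x : term Z n, x = 0.
  by move=> X0 x; rewrite -(iK n x) (X0 (khom_fun (cm i n) x)) raddf0.
have above : bounded_above X -> bounded_above Z.
  by move=> [N X0]; exists N => n /X0/Z0.
have below : bounded_below X -> bounded_below Z.
  by move=> [N X0]; exists N => n /X0/Z0.
by case: b bX => //= -[/above aZ /below bZ].
Qed.

Lemma cpxFL_retract b : idempotents_retract (cpxFL k gT b).
Proof.
move=> [X inX] e ee; have [Z [i [p [pi ip]]]] := cpx_retract kG_retract ee.
by exists (exist _ Z (in_cpxFL_retract pi inX)), i, p.
Qed.

End Modules.

Theorem theorem4p2 (k : comPzRingType) (gT : finGroupType) (V : kGmod k gT)
    (hV : free_of_finite_rank (carrier V)) (b : bdness) :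
  [/\ has_idempotent_completions (cpxFL k gT b),
      has_idempotent_completions (Kcat k gT b),
      has_idempotent_completions (Kcat_Vsplit b V),
      has_idempotent_completions (Kcat_tsVsplit b V)
    & has_idempotent_completions (Kcat_Vts b V)].
Proof.
have iC : has_idempotent_completions (cpxFL k gT b).
  exact/retract_completions/cpxFL_retract.
(* All four homotopy categories are instances of [quot_cat] over [cpxFL k gT b]. *)
by split=> //; apply: quot_completions iC _; apply: cpxFL_drazin.
Qed.
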